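(* For each integer $n\ge2$ let $m_n\in\{1,\dots,n-1\}$, and assume $m_n/n\to\alpha\in(0,1)$ as $n\to\infty$. Put $\delta_n=-\log\left(1-\frac{m_n}{n}\right)$ and let $k_n$ be any integer sequence such that $$\log n-k_n\delta_n\longrightarrow a\in\mathbb{R}.$$ Then, for every fixed integer $p\ge1$, $$\left\lVert (Q_{n,p}^{(m_n)})^{*k_n}-U_{n,p}\right\rVert_{\mathrm{TV}}\longrightarrow f_p(-a),$$ and $$\mathrm{sep}\!\left((Q_{n,p}^{(m_n)})^{*k_n},U_{n,p}\right)\longrightarrow\begin{cases}1-e^{-e^{a}}(1+e^{a}),&p=1,\\ 1-e^{-e^{a}},&p\ge2.\end{cases}$$
   Context: $G_{n,p}=C_p\wr S_n\cong C_p^n\rtimes S_n$ is the group of $p$-colored permutations, thought of as arrangements of a deck of $n$ cards labelled $1,\dots,n$, each card carrying a color in $C_p=\mathbb{Z}/p\mathbb{Z}$; the identity is the deck in order $1,2,\dots,n$ from top to bottom with all colors $0$. $U_{n,p}$ is the uniform distribution on $G_{n,p}$. One step of the $p$-colored top-$m$-to-random shuffle ($1\le m\le n$): remove the top $m$ cards, recolor those $m$ cards by independent uniform elements of $C_p$, apply a uniform random permutation to the removed block, choose an $m$-element set of final positions uniformly among all $\binom nm$ possibilities, and insert the removed cards into those positions; the remaining $n-m$ cards preserve their relative order and color. $Q_{n,p}^{(m)}$ is the one-step law on $G_{n,p}$, and $(Q_{n,p}^{(m)})^{*k}$ is its $k$-fold convolution power, i.e. the law of the deck after $k$ independent steps started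 from the identity. The hypothesis on $k_n$ makes $k_n\ge0$ for all sufficiently large $n$, which is all that matters for the limits. $\lVert M-U\rVert_{\mathrm{TV}}=\frac12\sum_x|M(x)-U(x)|$ and $\mathrm{sep}(M,U)=\max_x\left(1-\frac{M(x)}{U(x)}\right)$. With $y_+=\max(y,0)$, for $c\in\mathbb{R}$, $$f_p(c)=\sum_{\ell=0}^\infty a_{\ell,p}\bigl(s_{\ell,p}(e^{-c})-1\bigr)_+,\qquad a_{\ell,p}=\frac1{\ell!\,p^\ell}-\frac1{(\ell+1)!\,p^{\ell+1}},\qquad s_{\ell,p}(\lambda)=e^{-\lambda}\sum_{u=0}^{\ell}(p\lambda)^u .$$ *)

(* Defs.v *)
From HB Require Import structures.
From mathcomp Require Import all_boot all_order all_fingroup all_algebra.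
From mathcomp Require Import all_classical all_reals all_analysis.
Set Implicit Arguments.
Unset Strict Implicit.
Unset Printing Implicit Defensive.
Import Order.TTheory GRing.Theory Num.Theory.
Import numFieldNormedType.Exports.
Local Open Scope ring_scope.

(* C_p for p >= 1, with the additive group structure of the integers mod p;
   'Z_p is not used because 'Z_1 is Z/2Z. *)
Notation color p := 'I_p.-1.+1.

(* A deck (c, s): the card at position i is s i, and its color is c i.
   Positions and labels start at 0, and position 0 is the top. *)
Definition colored_perm (n p : nat) : Type :=
  ({ffun 'I_n -> color p} * 'S_n)%type.
HB.instance Definition _ n p := Finite.on (colored_perm n p).

Section ColoredPermGroup.
Variables n p : nat.
Implicit Types x y z : colored_perm n p.

(* The product x * y is the deck obtained from x by the rearrangement y: the
   new card at position i is the one x has at position y.2 i, and y.1 i is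
   added to its color.  In MathComp, (s * t) i = t (s i) for permutations. *)
Definition cpmul x y : colored_perm n p :=
  ([ffun i => x.1 (y.2 i) + y.1 i], (y.2 * x.2)%g).
Definition cpone : colored_perm n p := ([ffun=> 0], 1%g).
Definition cpinv x : colored_perm n p :=
  ([ffun i => - x.1 ((x.2^-1)%g i)], (x.2^-1)%g).

Lemma cpmulA : associative cpmul.
Proof.
move=> x y z; rewrite /cpmul /= mulgA; congr pair.
by apply/ffunP => i; rewrite !ffunE permM addrA.
Qed.

Lemma cpmul1 : left_id cpone cpmul.
Proof.
case=> c s; rewrite /cpmul /= mulg1; congr pair.
by apply/ffunP => i; rewrite !ffunE add0r.
Qed.

Lemma cpmulV : left_inverse cpone cpinv cpmul.
Proof.
case=> c s; rewrite /cpmul /cpone /= mulgV; congr pair.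
by apply/ffunP => i; rewrite !ffunE permK addNr.
Qed.

HB.instance Definition _ :=
  Finite_isGroup.Build (colored_perm n p) cpmulA cpmul1 cpmulV.

End ColoredPermGroup.

Section Insertion.
Variable n : nat.
Implicit Types (A : {set 'I_n}) (i j : 'I_n).

Definition rank_in A i : nat := #|[set j in A | (j < i)%N]|.

Lemma rank_in_lt A i : i \in A -> (rank_in A i < #|A|)%N.
Proof.
move=> iA; apply: proper_card; apply/properP; split.
  by apply/fintype.subsetP => j; rewrite inE => /andP[].
by exists i; rewrite // inE ltnn andbF.
Qed.

Lemma rank_in_mono A i j : i \in A -> (i < j)%N -> (rank_in A i < rank_in A j)%N.
Proof.
move=> iA ij; apply: proper_card; apply/properP; split.
  apply/fintype.subsetP => k; rewrite !inE => /andP[-> ki] /=.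
  exact: ltn_trans ki ij.
by exists i; rewrite !inE ?iA ?ltnn.
Qed.

Lemma rank_in_inj A : {in A &, injective (rank_in A)}.
Proof.
move=> i j iA jA e; apply: val_inj; case: (ltngtP (val i) (val j)) => // ij.
  by have := rank_in_mono iA ij; rewrite e ltnn.
by have := rank_in_mono jA ij; rewrite e ltnn.
Qed.

(* Insertion of the top #|A| cards into the positions of A: the positions of A
   receive, in order, the cards at positions 0, ..., #|A| - 1, and the other
   positions receive, in order, the remaining cards. *)
Definition insertion_nat A i : nat :=
  if i \in A then rank_in A i else (#|A| + rank_in (~: A) i)%N.

Lemma insertion_nat_lt A i : (insertion_nat A i < n)%N.
Proof.
rewrite /insertion_nat; case: ifPn => iA.
  apply: leq_trans (rank_in_lt iA) _.
  by rewrite -[X in (_ <= X)%N]card_ord max_card.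
rewrite -[X in (_ < X)%N]card_ord -(cardsC A) ltn_add2l.
by apply: rank_in_lt; rewrite inE.
Qed.

Definition insertion_fun A i : 'I_n := Ordinal (insertion_nat_lt A i).

Lemma insertion_fun_inj A : injective (insertion_fun A).
Proof.
move=> i j /(congr1 val) /=; rewrite /insertion_nat.
case: ifPn => iA; case: ifPn => jA.
- exact: rank_in_inj.
- by move=> e; have := rank_in_lt iA; rewrite e ltnNge leq_addr.
- by move=> e; have := rank_in_lt jA; rewrite -e ltnNge leq_addr.
- by move/addnI; apply: rank_in_inj; rewrite inE.
Qed.

Definition insertion A : 'S_n := perm (@insertion_fun_inj A).

End Insertion.

Section TopShuffle.
Variables n p m : nat.

Local Notation choice := ({ffun 'I_n -> color p} * 'S_n * {set 'I_n})%type.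

(* The choices (c, s, A) made in one step: the recoloring c and the permutation
   s act on the top m positions only, and A is the set of final positions. *)
Definition shuffle_choices : {set choice} :=
  [set w : choice | [&& [forall i : 'I_n, (m <= i)%N ==> (w.1.1 i == 0)],
               perm_on [set i : 'I_n | (i < m)%N] w.1.2 & #|w.2| == m]].

Definition shuffle_outcome (w : choice) : colored_perm n p :=
  ((w.1 : colored_perm n p) *
   (([ffun=> 0], insertion w.2) : colored_perm n p))%g.

(* Meaningful for m <= n, when shuffle_choices is nonempty. *)
Definition top_to_random (R : realFieldType) (g : colored_perm n p) : R :=
  #|[set w in shuffle_choices | shuffle_outcome w == g]|%:R /
  #|shuffle_choices|%:R.

End TopShuffle.

Section Laws.
Variables (R : realFieldType) (gT : finGroupType).
Implicit Types M N U : gT -> R.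

Definition unif : gT -> R := fun=> #|gT|%:R^-1.

Definition conv M N : gT -> R := fun x => \sum_y M y * N (y^-1 * x)%g.

Definition conv_pow M (k : nat) : gT -> R :=
  iter k (fun N => conv N M) (fun x => (x == 1%g)%:R).

Definition tv_dist M U : R := 2^-1 * \sum_x `|M x - U x|.

(* The default value of the iterated maximum is one of the terms. *)
Definition sep_dist M U : R :=
  \big[Num.max/(1 - M 1%g / U 1%g)]_x (1 - M x / U x).

End Laws.

Arguments unif R gT : clear implicits.
Arguments top_to_random n p m R g : clear implicits.

Section LimitProfile.
Variables (R : realType) (p : nat).

Definition profile_a (l : nat) : R :=
  (l`!%:R * p%:R ^+ l)^-1 - (l.+1`!%:R * p%:R ^+ l.+1)^-1.

Definition profile_s (l : nat) (lam : R) : R :=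
  expR (- lam) * \sum_(u < l.+1) (p%:R * lam) ^+ u.

Definition profile (c : R) : R :=
  limn (series (fun l => profile_a l *
                         Num.max (profile_s l (expR (- c)) - 1) 0)).

End LimitProfile.

(* Main.v *)
Require Import Defs.
From mathcomp Require Import all_boot all_order all_fingroup all_algebra.
From mathcomp Require Import all_classical all_reals all_analysis.
From mathcomp Require Import zify ring lra.
Import Order.TTheory GRing.Theory Num.Theory.
Import numFieldNormedType.Exports.
Local Open Scope ring_scope.
Set Implicit Arguments.
Unset Strict Implicit.
Unset Printing Implicit Defensive.

(** The deck is read through its inverse.  The inverse of one step takes a
    uniform set of m cards, in uniform order and with uniform colors, to the top
    and leaves the other cards as they were.  Such moves compose like words
    without repetition: putting the m cards of one word on top of a deck whose
    top j cards come from another word gives a deck whose top cards are those of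
    the two words together, and whose remaining cards are in the original order
    ([put_on_top_sort_tail]).  All of this commutes with relabelling the cards,
    and relabellings act simply transitively on decks, so that given the number
    of cards in the union of the two words the new top word is uniform
    ([conv_tail_law]).  Therefore the law after k steps is a mixture, over the
    number U of cards that were never moved, of the laws in which the n - U other
    cards are uniformly shuffled into the deck ([conv_pow_mixture]).

    A fixed set of r cards is missed by one step with probability
    C(n-m,r) / C(n,r), hence E C(U,r) = C(n,r) (C(n-m,r) / C(n,r))^k, and
    inclusion-exclusion gives the law of U.  In the regime of the theorem the
    mean n (1 - m/n)^k tends to lambda = e^a, all these binomial moments tend to
    lambda^r / r!, and they are bounded by mean^r / r!; so U converges in law to
    a Poisson variable of parameter lambda ([cvg_untouched_law]).

    Call level of a deck the largest l such that the cards with the l last labels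
    have color 0 and lie in their original relative order.  A deck of level l has
    density sum_(u <= l) P(U = u) u! p^u with respect to the uniform law
    ([conv_pow_density]), which tends to s_l(lambda), and a uniform deck has
    level at least l with probability 1 / (l! p^l) ([card_level_ge]).  The total
    variation distance is the uniform mean of the positive part of density - 1;
    its terms are dominated by those of an exponential series, which allows the
    passage to the limit under the sum ([tannery]).  The density increases with
    the level, so the separation is attained at the lowest level, which is 0 for
    p >= 2, and 1 for p = 1 because a single card is always in order. *)

(** * Sorting the bottom of a deck and putting cards on top *)

Section Decks.
Variables n p : nat.
Local Notation G := (colored_perm n p).
Implicit Types (x y z g h v : G) (s t : 'S_n) (i j m : nat) (q : 'I_n).

Lemma deck_mul_color x y q : ((x * y)%g : G).1 q = x.1 (y.2 q) + y.1 q.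
Proof. by rewrite /mulg /= ffunE. Qed.

Lemma deck_mul_perm x y q : ((x * y)%g : G).2 q = x.2 (y.2 q).
Proof. by rewrite /mulg /= permM. Qed.

Lemma deck_one_color q : (1%g : G).1 q = 0.
Proof. by rewrite /oneg /= ffunE. Qed.

Lemma deck_one_perm q : (1%g : G).2 q = q.
Proof. by rewrite /oneg /= perm1. Qed.

Lemma deckP x y : (forall q, x.1 q = y.1 q /\ x.2 q = y.2 q) -> x = y.
Proof.
case: x y => [c s] [d t] /= H; congr pair.
  by apply/ffunP => q; case: (H q).
by apply/permP => q; case: (H q).
Qed.

Definition agree i x y :=
  [forall q : 'I_n, (q < i)%N ==> (x.1 q == y.1 q) && (x.2 q == y.2 q)].

Definition increasing_from i s :=
  [forall q : 'I_n, forall q' : 'I_n, (i <= q < q')%N ==> (s q < s q')%N].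

Definition tail_sorted i x :=
  [forall q : 'I_n, (i <= q)%N ==> (x.1 q == 0)] && increasing_from i x.2.

Definition top i : {set 'I_n} := [set q : 'I_n | (q < i)%N].

Lemma agreeP i x y : 
  reflect (forall q, (q < i)%N -> x.1 q = y.1 q /\ x.2 q = y.2 q) (agree i x y).
Proof.
apply: (iffP forallP) => H q; first by move=> qi; have /implyP/(_ qi)/andP[/eqP ? /eqP ?] := H q.
by apply/implyP => /H[-> ->]; rewrite !eqxx.
Qed.

Lemma increasing_fromP i s :
  reflect (forall q q', (i <= q)%N -> (q < q')%N -> (s q < s q')%N)
    (increasing_from i s).
Proof.
apply: (iffP forallP) => H q; last first.
  by apply/forallP => q'; apply/implyP => /andP[]; apply: H.
by move=> q' iq qq'; have /forallP/(_ q')/implyP := H q; apply; rewrite iq.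
Qed.

Lemma tail_sortedP i x :
  reflect ((forall q, (i <= q)%N -> x.1 q = 0) /\
           (forall q q', (i <= q)%N -> (q < q')%N -> (x.2 q < x.2 q')%N))
    (tail_sorted i x).
Proof.
apply: (iffP andP) => -[H1 H2]; split.
- by move=> q iq; have /forallP/(_ q)/implyP/(_ iq)/eqP := H1.
- exact/increasing_fromP.
- by apply/forallP => q; apply/implyP => /H1 ->.
- exact/increasing_fromP.
Qed.

Lemma agree_sym i x y : agree i x y = agree i y x.
Proof. by apply/agreeP/agreeP => H q /H[-> ->]. Qed.

Lemma agree_trans i : transitive (agree i).
Proof.
by move=> y x z /agreeP H /agreeP K; apply/agreeP => q qi; case: (H q qi) => -> ->; exact: K.
Qed.

Lemma agreeW i j x y : (i <= j)%N -> agree j x y -> agree i x y.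
Proof. by move=> ij /agreeP H; apply/agreeP => q qi; apply: H; apply: leq_trans ij. Qed.

Lemma agree_mul i g x y : agree i (g * x)%g (g * y)%g = agree i x y.
Proof.
have K g' u v : agree i u v -> agree i (g' * u)%g (g' * v)%g.
  move=> /agreeP H; apply/agreeP => q qi; rewrite !deck_mul_color !deck_mul_perm.
  by case: (H q qi) => -> ->.
by apply/idP/idP => [/(K g^-1%g)|/K//]; rewrite !mulKg.
Qed.

Lemma tail_sortedW i j x : (i <= j)%N -> tail_sorted i x -> tail_sorted j x.
Proof.
move=> ij /tail_sortedP[H1 H2]; apply/tail_sortedP; split=> [q jq|q q' jq].
  exact/H1/(leq_trans ij).
exact/H2/(leq_trans ij).
Qed.

Lemma card_top i : (i <= n)%N -> #|top i| = i.
Proof.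
move=> le; rewrite -sum1_card (eq_bigl (fun q : 'I_n => (q < i)%N)); last first.
  by move=> q; rewrite inE.
by rewrite -(big_ord_widen n (fun=> 1%N) le) sum_nat_const card_ord muln1.
Qed.

(** At the first position of the tail where two such permutations differ, the
    smaller of the two values would have to occur earlier in the other one. *)
Lemma increasing_unique i s t : s @: top i = t @: top i ->
  increasing_from i s -> increasing_from i t ->
  forall q, (i <= q)%N -> s q = t q.
Proof.
move=> est /increasing_fromP Hs /increasing_fromP Ht q.
have key : forall s' t', s' @: top i = t' @: top i ->
    (forall q q' : 'I_n, (i <= q)%N -> (q < q')%N -> (t' q < t' q')%N) ->
    forall q, (i <= q)%N -> 
   (forall r : 'I_n, (r < q)%N -> (i <= r)%N -> s' r = t' r) -> (s' q < t' q)%N -> False.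
  move=> s' t' e Ht' r ir IH lt.
  pose q' := (t'^-1)%g (s' r); have e' : t' q' = s' r by rewrite permKV.
  have iq' : (i <= q')%N.
    rewrite leqNgt; apply/negP => q'i.
    have : s' r \in s' @: top i.
      by rewrite e; apply/imsetP; exists q'; rewrite ?inE ?q'i.
    by rewrite (mem_imset _ _ (@perm_inj _ s')) inE ltnNge ir.
  have q'r : (q' < r)%N.
    rewrite ltnNge leq_eqVlt; apply/negP => /orP[/eqP/val_inj rq'|/(Ht' _ _ ir)].
      by move: lt; rewrite -e' -rq' ltnn.
    by rewrite e' ltnNge ltnW.
  by have := IH _ q'r iq'; rewrite e' => /perm_inj q'e; move: q'r; rewrite q'e ltnn.
have [k] := ubnP q; elim: k q => // k IH q qk iq.
have IHq (r : 'I_n) : (r < q)%N -> (i <= r)%N -> s r = t r.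
  by move=> rq ir; apply: IH => //; lia.
apply: val_inj; case: (ltngtP (val (s q)) (val (t q))) => // lt.
  by case: (key s t est Ht q iq IHq lt).
by case: (key t s (esym est) Hs q iq _ lt) => r rq ir; rewrite IHq.
Qed.

Lemma tail_sorted_unique i x y :
  agree i x y -> tail_sorted i x -> tail_sorted i y -> x = y.
Proof.
move=> /agreeP A /andP[/forallP X1 X2] /andP[/forallP Y1 Y2]; apply: deckP => q.
have [qi|iq] := ltnP q i; first exact: A.
have /implyP/(_ iq)/eqP-> := X1 q; have /implyP/(_ iq)/eqP-> := Y1 q; split => //.
apply: (increasing_unique _ X2 Y2 iq); apply: eq_in_imset => r; rewrite inE.
by case/A.
Qed.

(** Among the permutations with the given top, one that maximizes the sum of
    q * s q is increasing below it, as swapping two values in decreasing order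
    would increase this sum. *)
Lemma tail_sorted_exists i h : exists v, agree i h v && tail_sorted i v.
Proof.
pose P s := [forall q : 'I_n, (q < i)%N ==> (s q == h.2 q)].
pose F s := (\sum_(q < n) q * s q)%N.
have P0 : P h.2 by apply/forallP => q; apply/implyP => _.
case: (@arg_maxnP _ h.2 P F P0) => s /forallP Ps maxs.
exists ([ffun q : 'I_n => if (q < i)%N then h.1 q else 0], s); apply/andP; split.
  apply/agreeP => q qi /=; rewrite ffunE qi; split=> //.
  by have /implyP/(_ qi)/eqP := Ps q.
apply/tail_sortedP; split=> /= [q iq|q q' iq qq']; first by rewrite ffunE ltnNge iq.
rewrite ltnNge; apply/negP => le.
have neq : q' != q by apply: contraTneq qq' => ->; rewrite ltnn.
have {le} lt : (s q' < s q)%N.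
  rewrite ltn_neqAle le andbT; apply: contra neq => /eqP/val_inj/perm_inj-> //.
have Pt : P (tperm q q' * s)%g.
  apply/forallP => r; apply/implyP => ri; rewrite permM tpermD.
  - by have /implyP := Ps r; apply.
  - by apply: contraTneq ri => <-; rewrite -leqNgt.
  - by apply: contraTneq ri => <-; rewrite -leqNgt (leq_trans iq) // ltnW.
have : (F (tperm q q' * s)%g <= F s)%N := maxs _ Pt.
rewrite leqNgt => /negP; apply.
rewrite /F (bigD1 q) //= (bigD1 q') //= [X in (_ < X)%N](bigD1 q) //=.
rewrite [X in (_ < _ + X)%N](bigD1 q') //= !permM tpermL tpermR.
rewrite [X in (_ < _ + (_ + X))%N](eq_bigr (fun r : 'I_n => (r * s r)%N)); last first.
  by move=> r /andP[rq rq']; rewrite permM tpermD // eq_sym.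
rewrite !addnA ltn_add2r; nia.
Qed.

Definition sort_tail i h : G := xchoose (tail_sorted_exists i h).

Lemma sort_tail_agree i h : agree i h (sort_tail i h).
Proof. by have /andP[] := xchooseP (tail_sorted_exists i h). Qed.

Lemma sort_tail_sorted i h : tail_sorted i (sort_tail i h).
Proof. by have /andP[] := xchooseP (tail_sorted_exists i h). Qed.

Lemma sort_tailE i h v : (sort_tail i h == v) = agree i h v && tail_sorted i v.
Proof.
apply/eqP/andP => [<-|[A T]]; first by rewrite sort_tail_agree sort_tail_sorted.
apply: (tail_sorted_unique _ (sort_tail_sorted i h) T).
by apply: agree_trans A; rewrite agree_sym sort_tail_agree.
Qed.

(** The cards on top of h are moved to the top of g and the others keep the
    order and the colors that they have in g.  Relabelling by the inverse of g
    reduces this to the case where g is the identity, in which the others are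
    sorted. *)
Definition put_on_top i h g : G := (g * sort_tail i (g^-1 * h))%g.

Lemma put_on_topE i h g v :
  (put_on_top i h g == v) = agree i h v && tail_sorted i (g^-1 * v)%g.
Proof.
rewrite -(agree_mul i (g^-1)%g h v) -sort_tailE /put_on_top.
by rewrite -[in RHS](inj_eq (mulgI g)) mulKVg.
Qed.

(** Left multiplication relabels the cards, which does not interfere with moving
    them. *)
Lemma put_on_top_mul i x h g : put_on_top i (x * h)%g (x * g)%g = (x * put_on_top i h g)%g.
Proof. by rewrite /put_on_top invMg -!mulgA mulKg. Qed.

Definition top_labels i h : {set 'I_n} := h.2 @: top i.

Lemma mem_top_labels i h q : (h.2 q \in top_labels i h) = (q < i)%N.
Proof. by rewrite (mem_imset _ _ (@perm_inj _ h.2)) inE. Qed.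

Lemma card_top_labels i h : (i <= n)%N -> #|top_labels i h| = i.
Proof. by move=> le; rewrite card_imset ?card_top //; exact: perm_inj. Qed.

Lemma agree_top_labels i x y : agree i x y -> top_labels i x = top_labels i y.
Proof. by move=> /agreeP A; apply: eq_in_imset => q; rewrite inE => /A[]. Qed.

Lemma deck_mulV_perm g x q : ((g^-1 * x)%g : G).2 q = (g.2^-1)%g (x.2 q).
Proof. by apply: (@perm_inj _ g.2); rewrite permKV -deck_mul_perm mulKVg. Qed.

Lemma mem_down_closed m (D : {set 'I_n}) :
    (forall q, q \in D -> (m <= q)%N) ->
    (forall q q', q' \in D -> (m <= q < q')%N -> q \in D) ->
  forall q, (m <= q)%N -> (q \in D) = (q < m + #|D|)%N.
Proof.
move=> Dm Dd q mq.
have card_seg k : (m <= k <= n)%N -> #|[set r : 'I_n | (m <= r < k)%N]| = (k - m)%N.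
  move=> /andP[mk kn]; have -> : [set r : 'I_n | (m <= r < k)%N] = top k :\: top m.
    by apply/setP => r; rewrite !inE; lia.
  by rewrite cardsDS ?card_top //; [lia|apply/fintype.subsetP => r; rewrite !inE; lia].
have qn := ltn_ord q.
apply/idP/idP => qD.
  have: [set r : 'I_n | (m <= r < q.+1)%N] \subset D.
    apply/fintype.subsetP => r; rewrite inE ltnS [(r <= q)%N]leq_eqVlt.
    case/andP=> mr /orP[/eqP/val_inj->//|rq]; apply: (Dd _ q) => //.
    by rewrite mr.
  by move/subset_leq_card; rewrite card_seg ?leq_subLR //; lia.
apply: contraLR qD => qD; rewrite -leqNgt.
have: D \subset [set r : 'I_n | (m <= r < q)%N].
  apply/fintype.subsetP => r rD; rewrite inE Dm //=.
  rewrite ltnNge leq_eqVlt; apply: contra qD => /orP[/eqP/val_inj->//|qr].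
  by apply: (Dd _ r) => //; rewrite mq.
by move/subset_leq_card; rewrite card_seg ?leq_subRL //; lia.
Qed.

Lemma deck_mulV_color g x q : ((g^-1 * x)%g : G).1 q = x.1 q - g.1 ((g.2^-1)%g (x.2 q)).
Proof.
by have := deck_mul_color g (g^-1 * x)%g q; rewrite mulKVg deck_mulV_perm => ->; rewrite addrC addKr.
Qed.

(** This is associativity of the product of words without repetition, with the
    deck h' cut after j cards as the second word.  By uniqueness it suffices to
    see that the right-hand side, below its top m cards, is ordered as in the deck
    sort_tail j h'.  Down to position i it lists the labels of B in the order of
    h', and sorting h' below j does not affect that; further down it lists labels
    outside B, which are sorted in both decks. *)
Lemma put_on_top_sort_tail m j h h' : (m <= n)%N -> (j <= n)%N ->
  put_on_top m h (sort_tail j h') =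
  sort_tail #|top_labels m h :|: top_labels j h'| (put_on_top m h h').
Proof.
move=> mn jn; set A := top_labels m h; set B := top_labels j h'.
set i := #|A :|: B|; set d := put_on_top m h h'; set y := sort_tail j h'.
set e := sort_tail i d; apply/eqP; rewrite put_on_topE.
have mi : (m <= i)%N.
  by rewrite -(card_top_labels h mn); apply/subset_leq_card/finset.subsetUl.
have /andP[dh Td] : agree m h d && tail_sorted m (h'^-1 * d)%g by rewrite -put_on_topE.
have de : agree i d e := sort_tail_agree i d.
have Te : tail_sorted i e := sort_tail_sorted i d.
have hy : agree j h' y := sort_tail_agree j h'.
have Ty : tail_sorted j y := sort_tail_sorted j h'.
have By : B = top_labels j y by exact: agree_top_labels.
have Ad : A = top_labels m d by exact: agree_top_labels.
have hinB (l : 'I_n) : (l \in B) = ((h'.2^-1)%g l < j)%N.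
  by rewrite -{1}(permKV h'.2 l) mem_top_labels.
have yinB (l : 'I_n) : (l \in B) = ((y.2^-1)%g l < j)%N.
  by rewrite By -{1}(permKV y.2 l) mem_top_labels.
case/tail_sortedP: Td => Td1 Td2.
(* Below its top m cards, d has the labels of B first, as h' does; there are
   i - m of them outside A. *)
have dB q : (m <= q)%N -> (d.2 q \in B) = (q < i)%N.
  move=> mq; pose D := [set r : 'I_n | (m <= r)%N && (d.2 r \in B)].
  have iD : i = (m + #|D|)%N.
    have -> : i = (#|A| + #|B :\: A|)%N.
      rewrite -cardsUI; have -> : A :&: (B :\: A) = finset.set0.
        by apply/setP => l; rewrite !inE; case: (l \in A).
      rewrite cards0 addn0 /i; congr #|pred_of_set _|.
      by apply/setP => l; rewrite !inE; case: (l \in A).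
    rewrite card_top_labels //; congr addn; rewrite -(card_imset (mem D) (@perm_inj _ d.2)).
    apply: eq_card => l; rewrite -(permKV d.2 l) (mem_imset _ _ (@perm_inj _ d.2)) !inE.
    by rewrite {1}Ad mem_top_labels -leqNgt.
  have := @mem_down_closed m D; rewrite -iD => <- //; rewrite ?inE ?mq //.
    by move=> r; rewrite inE => /andP[].
  move=> r r'; rewrite !inE !hinB -!deck_mulV_perm => /andP[mr' lt] /andP[mr rr'].
  by rewrite mr /=; apply: ltn_trans lt; apply: Td2.
(* The top i labels of d, and hence of e, are those of the union of A and B. *)
have eB q : (m <= q)%N -> (e.2 q \in B) = (q < i)%N.
  move=> mq; have [qi|iq] := ltnP q i.
    by have [_ <-] := agreeP _ _ _ de q qi; rewrite dB.
  apply/negP => eqB.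
  have : e.2 q \in top_labels i e.
    rewrite -(agree_top_labels de).
    suff -> : top_labels i d = A :|: B by rewrite inE eqB orbT.
    apply/setP => l; rewrite -(permKV d.2 l) mem_top_labels inE Ad mem_top_labels.
    set r := (d.2^-1)%g l; have [rm|mr] /= := ltnP r m; last by rewrite -dB.
    by rewrite (leq_trans rm).
  by rewrite mem_top_labels ltnNge iq.
rewrite (agree_trans dh (agreeW mi de)) /=.
(* The labels of B have the same positions in h' as in y. *)
have yh (l : 'I_n) : l \in B -> (y.2^-1)%g l = (h'.2^-1)%g l.
  rewrite hinB => lj; apply: (@perm_inj _ y.2); rewrite permKV.
  by have [_ <-] := agreeP _ _ _ hy _ lj; rewrite permKV.
case/tail_sortedP: Te => Te1 Te2; case/tail_sortedP: Ty => Ty1 Ty2.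
apply/tail_sortedP; split=> [q mq|q q' mq qq'].
  rewrite deck_mulV_color; have [qi|iq] := ltnP q i.
    have [e1 e2] := agreeP _ _ _ de q qi; rewrite -e1 -e2.
    have dqB : d.2 q \in B by rewrite dB.
    have [<- _] := agreeP _ _ _ hy ((y.2^-1)%g (d.2 q)) (eq_ind _ is_true dqB _ (yinB _)).
    by rewrite yh // -deck_mulV_color Td1.
  by rewrite Te1 // Ty1 ?subr0 // leqNgt -yinB eB // -leqNgt.
have mq' : (m <= q')%N by lia.
rewrite !deck_mulV_perm; have [q'i|iq'] := ltnP q' i.
  have qi : (q < i)%N by lia.
  have [_ <-] := agreeP _ _ _ de q qi; have [_ <-] := agreeP _ _ _ de q' q'i.
  by rewrite !yh ?dB // -!deck_mulV_perm Td2.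
have yq' : (j <= (y.2^-1)%g (e.2 q'))%N by rewrite leqNgt -yinB eB // -leqNgt.
have [qi|iq] := ltnP q i.
  by apply: leq_trans yq'; rewrite -yinB eB.
have yq : (j <= (y.2^-1)%g (e.2 q))%N by rewrite leqNgt -yinB eB // -leqNgt.
rewrite ltnNge leq_eqVlt; apply/negP => /orP[/eqP/val_inj/perm_inj/perm_inj E|].
  by move: qq'; rewrite E ltnn.
by move/(Ty2 _ _ yq'); rewrite !permKV ltnNge ltnW // Te2.
Qed.

End Decks.

(** * The law of a deck with a uniform top and a sorted bottom *)

Lemma sum_mulg_left (V : nmodType) (gT : finGroupType) (x : gT) (F : gT -> V) :
  \sum_h F h = \sum_h F (x * h)%g.
Proof. exact: reindex_inj (mulgI x). Qed.

Lemma sum_mulg_right (V : nmodType) (gT : finGroupType) (x : gT) (F : gT -> V) :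
  \sum_h F h = \sum_h F (h * x)%g.
Proof. exact: reindex_inj (mulIg x). Qed.

Lemma card_setC_ord n (A : {set 'I_n}) : #|~: A| = (n - #|A|)%N.
Proof. by rewrite cardsCs finset.setCK card_ord. Qed.

Section TailLaw.
Variables (R : realFieldType) (n p : nat).
Hypothesis p_gt0 : (0 < p)%N.
Local Notation G := (colored_perm n p).
Implicit Types (x y z g h v : G) (s t : 'S_n) (i j m : nat) (q : 'I_n).

Lemma card_agree i x : (i <= n)%N ->
  #|[set h | agree i x h]| = ((n - i)`! * p ^ (n - i))%N.
Proof.
move=> le; have -> : [set h | agree i x h] = (fun k => x * k)%g @: [set k | agree i 1%g k].
  apply/setP => h; rewrite -{2}(mulKVg x h) (mem_imset _ _ (mulgI x)) !inE.
  by rewrite -(agree_mul i x^-1%g) mulVg.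
rewrite card_imset; last exact: mulgI.
pose D := ~: top n i.
have cD : #|D| = (n - i)%N by rewrite card_setC_ord card_top.
rewrite (_ : [set k | agree i 1%g k] = finset.setX
   [set c : {ffun 'I_n -> color p} | c \in pffun_on 0 (mem D) predT]
   [set s | perm_on D s]).
  rewrite cardsX !cardsE card_pffun_on card_perm cD mulnC; congr (_ * _ ^ _)%N.
  by rewrite card_ord prednK.
apply/setP => -[c s]; rewrite !inE /=; apply/agreeP/andP => [H|[H1 H2] q qi].
  split.
    apply/pffun_onP; split=> //; apply/fintype.subsetP => q; rewrite !inE -leqNgt.
    by apply: contraR; rewrite -ltnNge => /H[]; rewrite deck_one_color => /= <-.
  apply/fintype.subsetP => q; rewrite !inE -leqNgt.
  by apply: contraR; rewrite -ltnNge => /H[_]; rewrite deck_one_perm => /= <-.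
rewrite deck_one_color deck_one_perm /=; split.
  have /pffun_onP[/fintype.subsetP/(_ q)] := H1; rewrite !inE qi /= => H _.
  by apply/eqP; rewrite eq_sym; apply/negP => /negP /H.
by rewrite (out_perm H2) // !inE qi.
Qed.

Lemma card_deck_neq0 : #|{: G}|%:R != 0 :> R.
Proof. by rewrite pnatr_eq0 -lt0n; apply/card_gt0P; exists 1%g. Qed.

Definition tail_law i v : R := (\sum_h (sort_tail i h == v)%:R) / #|{: G}|%:R.

Lemma tail_lawE i v : (i <= n)%N ->
  tail_law i v = (tail_sorted i v)%:R * ((n - i)`! * p ^ (n - i))%:R / #|{: G}|%:R.
Proof.
move=> le; congr (_ / _); rewrite -(card_agree v le) -sum1_card natr_sum.
rewrite mulr_sumr [RHS]big_mkcond; apply: eq_bigr => h _.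
by rewrite sort_tailE inE agree_sym; case: agree; case: tail_sorted; rewrite ?mulr1.
Qed.

Lemma sum_tail_law i : \sum_v tail_law i v = 1.
Proof.
rewrite -mulr_suml exchange_big /= (eq_bigr (fun=> 1)) => [|h _].
  by rewrite sumr_const divff // card_deck_neq0.
rewrite (bigD1 (sort_tail i h)) //= eqxx big1 ?addr0 // => v.
by rewrite eq_sym => /negbTE ->.
Qed.

Lemma card_tail_sorted i : (i <= n)%N ->
  #|[set v : G | tail_sorted i v]|%:R / #|{: G}|%:R =
  (((n - i)`! * p ^ (n - i))%:R)^-1 :> R.
Proof.
move=> le; have := sum_tail_law i.
under eq_bigr do rewrite tail_lawE // -mulrA.
rewrite -mulr_suml.
have -> : \sum_(v : G) (tail_sorted i v)%:R = #|[set v : G | tail_sorted i v]|%:R :> R.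
  rewrite -sum1_card natr_sum [RHS]big_mkcond; apply: eq_bigr => v _.
  by rewrite inE; case: tail_sorted.
have ne : (((n - i)`! * p ^ (n - i))%:R) != 0 :> R.
  by rewrite pnatr_eq0 -lt0n muln_gt0 fact_gt0 expn_gt0 p_gt0.
by move=> e; apply: (mulIf ne); rewrite mulVf //; apply: etrans e; rewrite mulrA mulrAC.
Qed.

(** The convolution is the law of the deck obtained by putting the top j cards of
    a uniform h' on the sorted version of a uniform h.  Relabelling h and h' by the
    same x keeps the number of distinct top labels and multiplies the deck by x;
    averaging over x makes the top word uniform for a given number of labels. *)
Lemma conv_tail_law i j v : (i <= n)%N -> (j <= n)%N ->
  Defs.conv (tail_law i) (tail_law j) v =
  (\sum_(h : G) \sum_(h' : G) tail_law #|top_labels j h' :|: top_labels i h| v) / #|{: G}|%:R ^+ 2.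
Proof.
move=> le_i le_j; have g0 := card_deck_neq0.
pose I h h' := #|top_labels j h' :|: top_labels i h|.
pose F x := \sum_(h : G) \sum_(h' : G) (sort_tail (I h h') (x * put_on_top j h' h)%g == v)%:R : R.
have top_mul x k y : top_labels k (x^-1 * y)%g = (x.2^-1)%g @: top_labels k y.
  rewrite /top_labels -imset_comp; apply: eq_in_imset => q _.
  exact: deck_mulV_perm.
have IE x h h' : I (x^-1 * h)%g (x^-1 * h')%g = I h h'.
  by rewrite /I !top_mul -imsetU card_imset //; exact: perm_inj.
have put_E x h h' : (x * put_on_top j (x^-1 * h') (x^-1 * h))%g = put_on_top j h' h.
  by rewrite put_on_top_mul mulKVg.
(* Changing variables by x^-1 in both sums removes x from F. *)
have FE x : F x = F 1%g.
  apply: (etrans (sum_mulg_left (x^-1)%g _)); apply: eq_bigr => h _.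
  apply: (etrans (sum_mulg_left (x^-1)%g _)); apply: eq_bigr => h' _.
  by rewrite IE put_E mul1g.
have -> : Defs.conv (tail_law i) (tail_law j) v = F 1%g / #|{: G}|%:R ^+ 2.
  rewrite /Defs.conv /tail_law; transitivity (\sum_y (\sum_(h : G) \sum_(h' : G)
      (sort_tail i h == y)%:R * (sort_tail j h' == (y^-1 * v)%g)%:R) / #|{: G}|%:R ^+ 2 : R).
    apply: eq_bigr => y _; rewrite mulrACA -invfM -expr2; congr (_ / _).
    rewrite mulr_suml; apply: eq_bigr => h _; rewrite mulr_sumr.
    by apply: eq_bigr.
  rewrite -mulr_suml; congr (_ / _); rewrite exchange_big; apply: eq_bigr => h _.
  rewrite exchange_big /=; set y := sort_tail i h.
  transitivity (\sum_(h' : G) (sort_tail j h' == (y^-1 * v)%g)%:R : R).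
    apply: eq_bigr => h' _; rewrite (bigD1 y) //= eqxx mul1r big1 ?addr0 // => z.
    by rewrite eq_sym => /negbTE ->; rewrite mul0r.
  apply: (etrans (sum_mulg_left (y^-1)%g _)); apply: eq_bigr => h' _.
  rewrite mul1g -put_on_top_sort_tail // /put_on_top; congr (_%:R); congr nat_of_bool.
  by rewrite -[in RHS](inj_eq (mulgI y^-1%g)) mulKg.
congr (_ / _); apply: (mulIf g0); transitivity (\sum_x F x).
  by rewrite (eq_bigr (fun=> F 1%g)) // sumr_const mulr_natr.
rewrite exchange_big mulr_suml; apply: eq_bigr => h _.
rewrite exchange_big mulr_suml; apply: eq_bigr => h' _ /=.
rewrite /tail_law (divfK g0).
exact: esym (sum_mulg_right (put_on_top j h' h)
  (fun x => (sort_tail (I h h') x == v)%:R)).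
Qed.

End TailLaw.

Section Moments.
Variables (n p : nat).
Local Notation G := (colored_perm n p).
Implicit Types (h : G) (A : {set 'I_n}).

Lemma insertion_lt A (q : 'I_n) : (insertion A q < #|A|)%N = (q \in A).
Proof.
rewrite permE /= /insertion_nat; case: ifPn => qA; first by rewrite rank_in_lt.
by rewrite ltnNge leq_addr.
Qed.

Lemma insertion_top A : insertion A @: A = top n #|A|.
Proof.
apply/setP => q; rewrite -(permKV (insertion A) q) (mem_imset _ _ (@perm_inj _ _)).
by rewrite inE insertion_lt.
Qed.

Definition avoiding j A : nat := #|[set h : G | [disjoint top_labels j h & A]]|.

(** Relabelling by [insertion A] turns A into an initial segment. *)
Lemma avoiding_top j A : avoiding j A = avoiding j (top n #|A|).
Proof.
pose g : G := ([ffun=> 0], insertion A).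
rewrite /avoiding -(card_imset (mem [set h : G | [disjoint top_labels j h & A]]) (mulgI g)).
apply: eq_card => h; rewrite -(mulKVg g h) (mem_imset _ _ (mulgI g)) !inE.
rewrite -insertion_top.
have -> : top_labels j (g * (g^-1 * h))%g = insertion A @: top_labels j (g^-1 * h)%g.
  by rewrite /top_labels -imset_comp; apply: eq_imset => q; exact: deck_mul_perm.
by rewrite imset_disjoint //; exact: perm_inj.
Qed.

(** Double counting: each deck is avoided by the r-subsets of the complement of
    its top labels. *)
Lemma sum_avoiding j r : (j <= n)%N ->
  (\sum_(A : {set 'I_n} | #|A| == r) avoiding j A = #|{: G}| * 'C(n - j, r))%N.
Proof.
move=> jn; rewrite /avoiding; under eq_bigr do rewrite -sum1_card big_mkcond.
rewrite exchange_big /= -sum_nat_const; apply: eq_bigr => h _.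
rewrite -big_mkcondr -[X in 'C(n - X, _)](card_top_labels h jn).
rewrite -card_setC_ord.
rewrite -cards_draws -[RHS]sum1_card; apply: eq_bigl => A.
rewrite !finset.in_set andbC. by rewrite finset.disjoints_subset finset.subsetC.
Qed.

(** By symmetry all sets of the same size contribute equally to [sum_avoiding]. *)
Lemma avoiding_card j A : (j <= n)%N ->
  (avoiding j A * 'C(n, #|A|) = #|{: G}| * 'C(n - j, #|A|))%N.
Proof.
move=> jn; have cC : #|[set B : {set 'I_n} | #|B| == #|A|]| = 'C(n, #|A|).
  by rewrite card_draws card_ord.
rewrite -sum_avoiding // mulnC -cC -sum_nat_const.
rewrite big_mkcond [RHS]big_mkcond; apply: eq_bigr => B _; rewrite inE.
by case: eqP => // e; rewrite avoiding_top -e -avoiding_top.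
Qed.

(** Both sides count the r-sets of labels avoided by the two top words, which are
    independent. *)
Lemma sum_untouched i j r : (i <= n)%N -> (j <= n)%N ->
  ((\sum_(h : G) \sum_(h' : G) 'C(n - #|top_labels j h' :|: top_labels i h|, r))
     * 'C(n, r) = #|{: G}| ^ 2 * 'C(n - i, r) * 'C(n - j, r))%N.
Proof.
move=> le_i le_j; transitivity ((\sum_(A : {set 'I_n} | #|A| == r)
    avoiding i A * avoiding j A) * 'C(n, r))%N.
  congr (_ * _)%N; rewrite /avoiding.
  transitivity (\sum_(A : {set 'I_n} | #|A| == r) \sum_(h : G) \sum_(h' : G)
     [disjoint top_labels i h & A] * [disjoint top_labels j h' & A])%N.
    rewrite [RHS]exchange_big; apply: eq_bigr => h _.
    rewrite [RHS]exchange_big; apply: eq_bigr => h' _.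
    set U := _ :|: _; rewrite -card_setC_ord.
    rewrite -cards_draws -sum1_card big_mkcond [RHS]big_mkcond; apply: eq_bigr => A _.
    rewrite inE /U finset.subsetC -finset.disjoints_subset; case: eqP => _; rewrite ?andbF ?andbT //.
    have -> : [disjoint top_labels j h' :|: top_labels i h & A] =
       [disjoint top_labels j h' & A] && [disjoint top_labels i h & A].
      by rewrite -!setI_eq0 finset.setIUl finset.setU_eq0.
    by case: [disjoint _ & _]; case: [disjoint _ & _].
  apply: eq_bigr => A _; rewrite -!sum1_card big_distrl [RHS]big_mkcond; apply: eq_bigr => h _ /=.
  rewrite inE mul1n; case: [disjoint _ & _]; last by rewrite big1.
  by rewrite [RHS]big_mkcond; apply: eq_bigr => h' _; rewrite inE mul1n; case: [disjoint _ & _].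
transitivity ((#|{: G}| * 'C(n - i, r)) * (#|{: G}| * 'C(n - j, r)))%N.
  rewrite -(sum_avoiding r le_i) !big_distrl; apply: eq_bigr => A /eqP <- /=.
  by rewrite -mulnA avoiding_card.
by rewrite mulnACA mulnn mulnA.
Qed.

End Moments.

(** * One step of the shuffle, inverted *)

Section OneStep.
Variables (n p : nat).
Local Notation G := (colored_perm n p).
Implicit Types (x y z g h v : G) (A : {set 'I_n}) (q : 'I_n).

Definition insertion_deck A : G := ([ffun=> 0], insertion A).

Lemma insertion_lt_out A q q' : q \notin A -> q' \notin A ->
  (q < q')%N -> (insertion A q < insertion A q')%N.
Proof.
move=> qA q'A lt; rewrite !permE /= /insertion_nat (negbTE qA) (negbTE q'A).
by rewrite ltn_add2l rank_in_mono // inE.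
Qed.

Lemma deck_inv_color g q : (g^-1%g : G).1 q = - g.1 ((g.2^-1)%g q).
Proof. by rewrite /invg /= ffunE. Qed.

Lemma deck_inv_perm g : (g^-1%g : G).2 = (g.2^-1)%g.
Proof. by []. Qed.

(** Inverting the step turns the set of final positions into the set of labels
    that the inverse deck has on top. *)
Lemma shuffle_outcome_inv m (w : G * {set 'I_n}) : w \in shuffle_choices n p m ->
  tail_sorted m (shuffle_outcome w)^-1%g /\
  w.2 = top_labels m (shuffle_outcome w)^-1%g.
Proof.
case: w => [[c s] A]; rewrite inE /= => /and3P[/forallP c0 sm /eqP cA].
pose k : G := (((c, s) : G)^-1)%g; pose v : G := ((insertion_deck A)^-1 * k)%g.
have -> : ((shuffle_outcome (c, s, A))^-1)%g = v by exact: invMg.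
have k2 q : (m <= q)%N -> k.2 q = q.
  by move=> mq; rewrite deck_inv_perm (out_perm (perm_onV sm)) // inE -leqNgt.
have k1 q : (m <= q)%N -> k.1 q = 0.
  move=> mq; rewrite deck_inv_color -deck_inv_perm k2 //= .
  by have /implyP/(_ mq)/eqP -> := c0 q; rewrite oppr0.
have v2 q : (m <= q)%N -> v.2 q = ((insertion A)^-1)%g q.
  by move=> mq; rewrite deck_mulV_perm k2.
have vA q : (m <= q)%N -> v.2 q \notin A.
  by move=> mq; rewrite v2 // -insertion_lt permKV cA -leqNgt.
split.
  apply/tail_sortedP; split=> [q mq|q q' mq qq'].
    by rewrite deck_mulV_color k1 //= ffunE subr0.
  have mq' : (m <= q')%N by lia.
  rewrite ltnNge leq_eqVlt; apply/negP => /orP[/eqP/val_inj/perm_inj E|].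
    by move: qq'; rewrite E ltnn.
  move/(insertion_lt_out (vA _ mq') (vA _ mq)).
  by rewrite !v2 // !permKV ltnNge ltnW.
apply/eqP; rewrite finset.eqEsubset; apply/andP; split; last first.
  apply/fintype.subsetP => l /imsetP[q]; rewrite inE => qm ->.
  rewrite deck_mulV_perm -insertion_lt cA permKV.
  rewrite ltnNge; apply/negP => mk; have := qm; rewrite ltnNge => /negP; apply.
  by have /perm_inj e := k2 _ mk; rewrite -e.
apply/fintype.subsetP => l lA; rewrite -(permKV v.2 l) mem_top_labels ltnNge.
by apply/negP => /vA; rewrite permKV lA.
Qed.

(** The set of positions is read off the inverse deck v, and removing the insertion
    from v leaves a deck that is trivial below position m, since the insertion and
    v are both increasing there; its inverse is the recoloring and permutation of
    the top block. *)
Lemma card_shuffle_outcome m g : (m <= n)%N ->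
  #|[set w in shuffle_choices n p m | shuffle_outcome w == g]| =
  tail_sorted m g^-1%g.
Proof.
move=> mn; case: (boolP (tail_sorted m _)) => [T|nT] /=; last first.
  apply/eqP; rewrite cards_eq0; apply/eqP/setP => w; rewrite [RHS]inE inE.
  apply/negP => /andP[/shuffle_outcome_inv[T _] /eqP e].
  by move: nT; rewrite -e T.
set v := (g^-1)%g in T; pose A := top_labels m v; pose I := insertion_deck A.
have cA : #|A| = m by exact: card_top_labels.
pose z : G := (I * v)%g.
have /tail_sortedP[T1 T2] := T.
have vA q : (m <= q)%N -> v.2 q \notin A by move=> mq; rewrite mem_top_labels -leqNgt.
have z2 q : (m <= q)%N -> z.2 q = q.
  move=> mq; rewrite -[RHS]perm1; apply: (@increasing_unique n m z.2 1%g) => //.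
  - rewrite (eq_imset (g := insertion A \o v.2)) => [|r]; last exact: deck_mul_perm.
    rewrite imset_comp insertion_top cA -[LHS]imset_id; apply: eq_imset => r.
    by rewrite perm1.
  - apply/increasing_fromP => r r' mr rr'; rewrite !deck_mul_perm.
    apply: insertion_lt_out; rewrite ?vA //; first by lia.
    exact: T2.
  - by apply/increasing_fromP => r r' _; rewrite !perm1.
have z1 q : (m <= q)%N -> z.1 q = 0.
  by move=> mq; rewrite deck_mul_color /= ffunE add0r T1.
have zV q : (m <= q)%N -> (z.2^-1)%g q = q.
  by move=> mq; rewrite -{1}(z2 q mq) permK.
have gE : g = (z^-1 * I)%g by rewrite /z invMg invgK mulgKV.
rewrite (_ : [set w in _ | _] = finset.set1 ((z^-1)%g : G, A)) ?cards1 //.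
apply/setP => w; rewrite inE finset.in_set1; apply/andP/eqP => [[wc /eqP e]|->].
  have [_ wA] := shuffle_outcome_inv wc; rewrite e -/v -/A in wA.
  case: w wc e wA => [x B] _ e /= wA; subst B; congr pair.
  by apply: (mulIg I); rewrite -gE -e.
split; last by rewrite gE.
rewrite inE /= cA eqxx andbT; apply/andP; split.
  by apply/forallP => q; apply/implyP => mq; rewrite ffunE zV // z1 // oppr0.
apply/fintype.subsetP => q; rewrite !inE ltnNge; apply: contra => mq.
by rewrite zV.
Qed.

Lemma card_shuffle_choices m : (m <= n)%N ->
  #|shuffle_choices n p m| = #|[set v : G | tail_sorted m v]|.
Proof.
move=> mn; rewrite -!sum1_card (partition_big (@shuffle_outcome n p) predT) //=.
transitivity (\sum_(g : G) tail_sorted m g^-1%g)%N.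
  apply: eq_bigr => g _; rewrite -card_shuffle_outcome // -sum1_card.
  by apply: eq_bigl => w; rewrite [in RHS]inE.
transitivity (\sum_(v : G) tail_sorted m v)%N.
  exact: esym (reindex_inj invg_inj).
rewrite [RHS]big_mkcond; apply: eq_bigr => v _; rewrite inE.
by case: tail_sorted.
Qed.

Lemma top_to_randomE (R : realFieldType) m g : (0 < p)%N -> (m <= n)%N ->
  top_to_random n p m R g = tail_law R m g^-1%g.
Proof.
move=> p0 mn; rewrite /top_to_random card_shuffle_outcome // tail_lawE // -mulrA.
congr (_ * _); rewrite card_shuffle_choices //.
have := card_tail_sorted R p0 mn; set t := #|_|%:R; move=> e.
have t0 : t != 0.
  apply: contra_eq_neq e => ->; rewrite mul0r eq_sym invr_eq0 pnatr_eq0 -lt0n.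
  by rewrite muln_gt0 fact_gt0 expn_gt0 p0.
by rewrite -[in RHS](invrK _%:R) -e invfM invrK -mulrA mulfV ?mulr1 // card_deck_neq0.
Qed.

End OneStep.

(** * The number of cards never moved *)

Section Untouched.
Variable (R : realFieldType).

Lemma alternating_binomial_sum d N : (d < N)%N ->
  \sum_(s < N) (-1) ^+ s * 'C(d, s)%:R = (d == 0)%:R :> R.
Proof.
case: N => // N; rewrite ltnS; case: d => [_|d].
  rewrite big_ord_recl /= mulr1 big1 ?addr0 // => i _.
  by rewrite bin0n mulr0.
have key M : \sum_(s < M.+1) (-1) ^+ s * 'C(d.+1, s)%:R = (-1) ^+ M * 'C(d, M)%:R :> R.
  elim: M => [|M IH]; first by rewrite big_ord1 !bin0.
  by rewrite big_ord_recr /= IH binS natrD exprS; ring.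
by move=> dN; rewrite key bin_small // mulr0.
Qed.

Lemma bin_mul_bin v u s : ('C(v, u + s) * 'C(u + s, u) = 'C(v, u) * 'C(v - u, s))%N.
Proof.
have [le|lt] := leqP (u + s) v; last first.
  rewrite bin_small //; have [uv|uv] := leqP u v; last first.
    by rewrite [X in (_ = X * _)%N]bin_small ?mul0n.
  by rewrite [X in (_ = _ * X)%N]bin_small ?muln0 //; lia.
have us : (u <= u + s)%N by lia.
have uv : (u <= v)%N by lia.
have sv : (s <= v - u)%N by lia.
have e1 := bin_fact le; have e2 := bin_fact us; have e3 := bin_fact uv.
have e4 := bin_fact sv; rewrite addKn in e2; rewrite -subnDA in e4.
have pos : (0 < u`! * s`! * (v - (u + s))`!)%N by rewrite !muln_gt0 !fact_gt0.
apply/eqP; rewrite -(eqn_pmul2r pos); apply/eqP.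
transitivity v`!; first by rewrite -e1 -e2; ring.
by rewrite -e3 -e4; ring.
Qed.

(** Inclusion-exclusion: the weights are recovered from their binomial moments. *)
Lemma binomial_inversion N (w : nat -> R) u : (u <= N)%N ->
  w u = \sum_(s < N.+1) (-1) ^+ s * 'C(u + s, u)%:R *
                        \sum_(v < N.+1) w v * 'C(v, u + s)%:R.
Proof.
move=> uN; under eq_bigr do rewrite mulr_sumr.
have inner v : (v <= N)%N ->
    \sum_(s < N.+1) (-1) ^+ s * 'C(u + s, u)%:R * (w v * 'C(v, u + s)%:R) =
    w v * 'C(v, u)%:R * (v - u == 0)%N%:R.
  move=> vN; rewrite -(@alternating_binomial_sum (v - u) N.+1); last by lia.
  rewrite mulr_sumr; apply: eq_bigr => s _.
  have := bin_mul_bin v u s; move/(congr1 (fun i => i%:R : R)); rewrite !natrM => e.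
  transitivity (w v * (-1) ^+ s * ('C(v, u + s)%:R * 'C(u + s, u)%:R)); first by ring.
  by rewrite e; ring.
rewrite exchange_big (bigD1 (inord u)) //= inordK // inner // subnn binn !mulr1.
rewrite big1 ?addr0 // => v vu; rewrite inner; last by rewrite -ltnS.
have [lt|] := ltnP v u; first by rewrite bin_small // mulr0 mul0r.
rewrite leq_eqVlt => /orP[/eqP e|lt]; last by rewrite subn_eq0 leqNgt lt /= !mulr0.
by move: vu; rewrite e inord_val eqxx.
Qed.

(** The expectation of C(U, r), where U is the number of cards never moved in k
    steps: each of the C(n, r) sets of cards is missed by each step with
    probability C(n-m, r) / C(n, r). *)
Definition untouched_moment n m k r : R :=
  'C(n, r)%:R * ('C(n - m, r)%:R / 'C(n, r)%:R) ^+ k.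

(** The probability that U = u, by inclusion-exclusion on the binomial moments; the
    moments of order above n vanish, so that the sum may stop at any s >= n - u. *)
Definition untouched_law n m k u : R :=
  \sum_(s < n.+1) (-1) ^+ s * 'C(u + s, u)%:R * untouched_moment n m k (u + s).

Lemma tail_law0 n p x : tail_law R 0 x = (x == 1%g :> colored_perm n p)%:R.
Proof.
rewrite /tail_law (eq_bigr (fun=> (x == 1%g :> colored_perm n p)%:R)) => [|h _].
  by rewrite sumr_const -[X in X / _]mulr_natr mulfK // card_deck_neq0.
have -> : sort_tail 0 h = 1%g; last by rewrite eq_sym.
apply/eqP; rewrite sort_tailE; apply/andP; split; first exact/agreeP.
by apply/tail_sortedP; split=> q; rewrite ?deck_one_color // => q' _; rewrite !deck_one_perm.
Qed.

Lemma card_top_labelsU_le n p i j (h h' : colored_perm n p) :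
  (#|top_labels i h :|: top_labels j h'| <= n)%N.
Proof. by rewrite -[X in (_ <= X)%N]card_ord max_card. Qed.

(** Induction on k: a further step moves the mixture component with u cards left
    to components with at most u cards left, and [sum_untouched] says that this
    multiplies the r-th binomial moment by C(n-m, r) / C(n, r). *)
Lemma mixture_by_moments n p m k : (0 < p)%N -> (m <= n)%N ->
  exists w : nat -> R, [/\ forall u, 0 <= w u,
    forall r, \sum_(u < n.+1) w u * 'C(u, r)%:R = untouched_moment n m k r &
    forall x : colored_perm n p, conv_pow (top_to_random n p m R) k x =
       \sum_(u < n.+1) w u * tail_law R (n - u) x^-1%g].
Proof.
move=> p0 mn; elim: k => [|k [w [w0 wr wx]]].
  exists (fun u => (u == n)%:R); split=> [u|r|x]; first exact: ler0n.
    rewrite /untouched_moment expr0 mulr1 big_ord_recr /= eqxx mul1r big1 ?add0r // => u _.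
    by rewrite ltn_eqF // mul0r.
  rewrite big_ord_recr /= eqxx mul1r subnn tail_law0 invg_eq1 big1 ?add0r // => u _.
  by rewrite ltn_eqF // mul0r.
have g0 : #|{: colored_perm n p}|%:R ^+ 2 != 0 :> R by rewrite expf_neq0 // card_deck_neq0.
pose U u (h h' : colored_perm n p) := #|top_labels (n - u) h' :|: top_labels m h|.
have Un u h h' : (U u h h' <= n)%N by exact: card_top_labelsU_le.
pose w' u' : R := \sum_(u < n.+1) w u * ((\sum_(h : colored_perm n p)
   \sum_(h' : colored_perm n p) (n - U u h h' == u')%N%:R) / #|{: colored_perm n p}|%:R ^+ 2).
have w'E (F : nat -> R) : \sum_(u' < n.+1) w' u' * F u' =
    \sum_(u < n.+1) w u * ((\sum_(h : colored_perm n p) \sum_(h' : colored_perm n p)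
       F (n - U u h h')%N) / #|{: colored_perm n p}|%:R ^+ 2).
  rewrite /w'; under eq_bigr do rewrite mulr_suml.
  rewrite exchange_big /=; apply: eq_bigr => u _.
  under eq_bigr do rewrite -mulrA.
  rewrite -mulr_sumr; congr (_ * _).
  rewrite [RHS]mulr_suml.
  transitivity ((\sum_(u' < n.+1) (\sum_(h : colored_perm n p)
      \sum_(h' : colored_perm n p) (n - U u h h' == u')%N%:R) * F u')
      / #|{: colored_perm n p}|%:R ^+ 2).
    by rewrite mulr_suml; apply: eq_bigr => u' _; rewrite mulrAC.
  rewrite -[RHS]mulr_suml; congr (_ / _).
  under eq_bigr do rewrite mulr_suml.
  rewrite exchange_big; apply: eq_bigr => h _ /=.
  under eq_bigr do rewrite mulr_suml.
  rewrite exchange_big; apply: eq_bigr => h' _ /=.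
  have lt : (n - U u h h' < n.+1)%N by rewrite ltnS leq_subr.
  rewrite (bigD1 (Ordinal lt)) //= eqxx mul1r big1 ?addr0 // => u' ne.
  case: eqP => [e|]; last by rewrite mul0r.
  by move: ne; rewrite -val_eqE /= e eqxx.
exists w'; split=> [u'|r|x].
- apply: sumr_ge0 => u _; rewrite mulr_ge0 // divr_ge0 ?exprn_ge0 //.
  by do 2![apply: sumr_ge0 => ? _].
- rewrite (w'E (fun u => 'C(u, r)%:R)).
  have [nr|rn] := ltnP n r.
    rewrite /untouched_moment [in RHS]bin_small // mul0r big1 // => u _.
    rewrite big1 ?mul0r ?mulr0 // => h _; rewrite big1 // => h' _.
    by rewrite bin_small //; lia.
  have b0 : 'C(n, r)%:R != 0 :> R by rewrite pnatr_eq0 -lt0n bin_gt0.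
  transitivity (\sum_(u < n.+1) w u * 'C(u, r)%:R * ('C(n - m, r)%:R / 'C(n, r)%:R)).
    apply: eq_bigr => u _; rewrite -mulrA; congr (_ * _).
    apply: (mulIf g0); rewrite divfK //; apply: (mulIf b0).
    have := sum_untouched p r mn (leq_subr u n).
    rewrite subKn; last by rewrite -ltnS.
    move/(congr1 (fun N => N%:R : R)); rewrite -mulnn !natrM natr_sum.
    under eq_bigr do rewrite natr_sum.
    by move=> ->; field.
  rewrite -mulr_suml wr /untouched_moment exprS; ring.
- transitivity (\sum_(u < n.+1) w u * Defs.conv (tail_law R m) (tail_law R (n - u)) x^-1%g).
    rewrite /= /Defs.conv.
    transitivity (\sum_(y : colored_perm n p) \sum_(u < n.+1) w u *
       (tail_law R (n - u) y^-1%g * tail_law R m (x^-1 * y)%g)).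
      apply: eq_bigr => y _; rewrite wx top_to_randomE // invMg invgK mulr_suml.
      by apply: eq_bigr => u _; rewrite mulrA.
    rewrite exchange_big; apply: eq_bigr => u _; rewrite -mulr_sumr; congr (_ * _).
    apply: (etrans (sum_mulg_left x _)); apply: eq_bigr => y _.
    by rewrite mulKg invMg mulrC.
  rewrite (w'E (fun u => tail_law R (n - u) x^-1%g)); apply: eq_bigr => u _.
  rewrite (@conv_tail_law R n p m (n - u) _ mn (leq_subr u n)).
  apply: (congr1 (fun X : R => w u * (X / #|{: colored_perm n p}|%:R ^+ 2))).
  apply: eq_bigr => h _; apply: eq_bigr => h' _.
  by rewrite (subKn (Un u h h')).
Qed.

Lemma conv_pow_mixture n p m k : (0 < p)%N -> (m <= n)%N ->
  [/\ forall u, (u <= n)%N -> 0 <= untouched_law n m k u <= untouched_moment n m k u,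
    \sum_(u < n.+1) untouched_law n m k u = 1 &
    forall x : colored_perm n p, conv_pow (top_to_random n p m R) k x =
       \sum_(u < n.+1) untouched_law n m k u * tail_law R (n - u) x^-1%g].
Proof.
move=> p0 mn; have [w [w0 wr wx]] := mixture_by_moments k p0 mn.
have wE u : (u <= n)%N -> untouched_law n m k u = w u.
  move=> un; rewrite (binomial_inversion w un); apply: eq_bigr => s _.
  by rewrite wr.
split=> [u un||x].
- rewrite wE // w0 -wr (bigD1 (inord u)) //= inordK // binn mulr1.
  by rewrite lerDl sumr_ge0 // => v _; rewrite mulr_ge0.
- have := wr 0; rewrite /untouched_moment !bin0 divr1 expr1n mulr1 => e; apply: etrans e.
  by apply: eq_bigr => u _; rewrite bin0 mulr1 wE // -ltnS.
- by rewrite wx; apply: eq_bigr => u _; rewrite wE // -ltnS.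
Qed.

End Untouched.

(** * Density, total variation and separation *)

Section Distances.
Variables (R : realFieldType) (n p m k : nat).
Hypotheses (p_gt0 : (0 < p)%N) (mn : (m <= n)%N).
Local Notation G := (colored_perm n p).
Local Notation law := (conv_pow (top_to_random n p m R) k).

(** Read on x itself: the largest number u such that the cards with the last u
    labels have color 0 and lie in their original relative order. *)
Definition level (x : G) : nat :=
  (\max_(u < n.+1 | tail_sorted (n - u) x^-1%g) u)%N.

Lemma level_le x : (level x <= n)%N.
Proof. by apply/bigmax_leqP => u _; rewrite -ltnS. Qed.

Lemma leq_level u x : (u <= n)%N -> (u <= level x)%N = tail_sorted (n - u) x^-1%g.
Proof.
move=> un; apply/idP/idP => [|T]; last first.
  have uN : (u < n.+1)%N by [].
  exact: (@leq_bigmax_cond _ (fun u : 'I_n.+1 => tail_sorted (n - u) x^-1%g)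
     (fun u => u : nat) (Ordinal uN)).
have T0 : tail_sorted (n - (ord0 : 'I_n.+1)) x^-1%g.
  apply/tail_sortedP; rewrite subn0.
  by split=> [q|q q']; rewrite leqNgt ltn_ord.
have [v Tv e] := @eq_bigmax_cond _ (fun u : 'I_n.+1 => tail_sorted (n - u) x^-1%g)
   (fun u => u : nat) (ltac:(by apply/card_gt0P; exists ord0)).
have -> : level x = v by exact: e.
by move=> uv; apply: tail_sortedW Tv; rewrite leq_sub2l.
Qed.

(** Density of the law after k steps, with respect to the uniform law, at a deck of
    level l. *)
Definition density (l : nat) : R :=
  \sum_(u < l.+1) untouched_law R n m k u * (u`! * p ^ u)%:R.

Lemma untouched_law_ge0 u : (u <= n)%N -> 0 <= untouched_law R n m k u.
Proof. by move=> un; have [/(_ u un)/andP[]] := conv_pow_mixture R k p_gt0 mn. Qed.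

Lemma density_mono i j : (i <= j)%N -> (j <= n)%N -> density i <= density j.
Proof.
move=> ij jn; rewrite /density -(subnKC ij) -addSn big_split_ord /= lerDl.
apply: sumr_ge0 => u _; rewrite mulr_ge0 // untouched_law_ge0 //=.
by have := ltn_ord u; lia.
Qed.

Lemma conv_pow_density x : law x = density (level x) / #|{: G}|%:R.
Proof.
have [_ _ ->] := conv_pow_mixture R k p_gt0 mn; rewrite mulr_suml.
have ln : (level x < n.+1)%N by rewrite ltnS level_le.
rewrite (big_ord_widen n.+1 (fun u => untouched_law R n m k u * (u`! * p ^ u)%:R
   / #|{: G}|%:R) ln) [RHS]big_mkcond; apply: eq_bigr => u _.
have un : (u <= n)%N by rewrite -ltnS.
rewrite tail_lawE ?leq_subr // subKn // -leq_level // ltnS.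
by case: leqP => _ /=; rewrite ?mul1r ?mul0r ?mulr0 ?mulrA.
Qed.

Lemma card_level_ge l : (l <= n)%N ->
  #|[set x : G | (l <= level x)%N]|%:R / #|{: G}|%:R = ((l`! * p ^ l)%:R)^-1 :> R.
Proof.
move=> ln; have := card_tail_sorted R p_gt0 (leq_subr l n); rewrite subKn // => <-.
congr (_%:R / _); rewrite -(card_imset _ invg_inj); apply: eq_card => x.
by rewrite -(invgK x) (mem_imset _ _ invg_inj) !finset.in_set leq_level // invgK.
Qed.

Definition level_prob (l : nat) : R :=
  ((l`! * p ^ l)%:R)^-1 - (if (l < n)%N then ((l.+1`! * p ^ l.+1)%:R)^-1 else 0).

(** [level_prob] is the law of the level of a uniform deck. *)
Lemma sum_level (f : nat -> R) :
  \sum_x f (level x) / #|{: G}|%:R = \sum_(l < n.+1) level_prob l * f l.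
Proof.
have inL x : (level x < n.+1)%N by rewrite ltnS level_le.
rewrite (partition_big (fun x => Ordinal (inL x)) predT) //=.
apply: eq_bigr => l _; have ln : (l <= n)%N by rewrite -ltnS.
rewrite (eq_bigr (fun=> f l / #|{: G}|%:R)) => [|x /eqP <- //].
rewrite sumr_const -[LHS]mulr_natr mulrC mulrA mulrAC; congr (_ * _).
rewrite /level_prob -card_level_ge //.
pose E i := [set x : G | (i <= level x)%N].
have EE : #|E l| = (#|[pred x | Ordinal (inL x) == l]| + #|E l.+1|)%N.
  have sE : E l.+1 \subset E l by apply/fintype.subsetP => x; rewrite !inE; apply: ltnW.
  rewrite -[LHS](cardsID (E l.+1)) addnC; congr (_ + _)%N.
    by apply: eq_card => x; rewrite !inE -val_eqE /= -leqNgt eqn_leq andbC.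
  by congr #|pred_of_set _|; apply/finset.setIidPr.
have -> : (if (l < n)%N then ((l.+1`! * p ^ l.+1)%:R)^-1 else 0) =
    #|E l.+1|%:R / #|{: G}|%:R :> R.
  case: ifP => [lt|]; first by rewrite card_level_ge.
  move=> /negbT; rewrite -leqNgt => nl.
  suff -> : #|E l.+1| = 0%N by rewrite mul0r.
  apply/eqP; rewrite cards_eq0; apply/eqP/setP => x; rewrite !inE.
  by apply/negbTE; rewrite -leqNgt (leq_trans (level_le x)).
by rewrite -/(E l) EE natrD mulrDl addrK mulrC.
Qed.

Lemma sum_law : \sum_x law x = 1.
Proof.
have [_ s1 law_E] := conv_pow_mixture R k p_gt0 mn.
under eq_bigr do rewrite law_E.
rewrite exchange_big /= -[RHS]s1; apply: eq_bigr => u _; rewrite -mulr_sumr.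
rewrite -[RHS]mulr1 -(sum_tail_law R n p (n - u)); congr (_ * _).
exact: esym (reindex_inj invg_inj).
Qed.

(** Since |y| = 2 max(y, 0) - y and the differences sum to zero, the distance is the
    sum of the positive parts. *)
Lemma tv_dist_density : tv_dist law (unif R G) =
  \sum_(l < n.+1) level_prob l * Num.max (density l - 1) 0.
Proof.
have g0 : #|{: G}|%:R != 0 :> R by exact: card_deck_neq0.
pose D x := law x - #|{: G}|%:R^-1.
have sD : \sum_x D x = 0.
  by rewrite big_split /= sum_law sumr_const -[X in 1 + X]mulr_natl mulrN mulfV ?subrr.
have DE x : D x = (density (level x) - 1) / #|{: G}|%:R.
  by rewrite /D conv_pow_density mulrBl mul1r.
rewrite /tv_dist; apply: etrans _ (sum_level (fun l => Num.max (density l - 1) 0)).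
transitivity (2^-1 * (\sum_x `|D x| + \sum_x D x)); first by rewrite sD addr0.
rewrite -big_split mulr_sumr; apply: eq_bigr => x _ /=.
rewrite DE normrM [`|_^-1|]ger0_norm // -mulrDl mulrA; congr (_ / _).
case: (leP (density (level x) - 1) 0) => h.
  by rewrite ler0_norm // addNr mulr0.
by rewrite ger0_norm ?ltW //; lra.
Qed.

(** The condition on l says that every deck has level at least l, and the condition
    on l + 1 that some deck has level exactly l; the density is smallest there. *)
Lemma sep_dist_density l : (l < n)%N -> (l`! * p ^ l = 1)%N ->
  (1 < l.+1`! * p ^ l.+1)%N -> sep_dist law (unif R G) = 1 - density l.
Proof.
move=> ln l1 l2; have g0 : #|{: G}|%:R != 0 :> R by exact: card_deck_neq0.
have sepE x : 1 - law x / unif R G x = 1 - density (level x).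
  by rewrite /unif conv_pow_density invrK divfK.
have lel x : (l <= level x)%N.
  have : #|[set x : G | (l <= level x)%N]| = #|{: G}|.
    apply/eqP; rewrite -(eqr_nat R); apply/eqP.
    rewrite -[LHS](divfK g0) card_level_ge; last exact: ltnW.
    by rewrite l1 invr1 mul1r.
  move/eqP; rewrite -cardsT; move: (finset.subsetT [set x : G | (l <= level x)%N]).
  move=> /subset_leqif_cards[_ ->] /eqP /setP /(_ x).
  by rewrite !finset.in_set.
have /existsP[x /eqP lx] : [exists x : G, level x == l].
  apply: contraT; rewrite negb_exists => /forallP ne.
  have lt x : (l.+1 <= level x)%N by rewrite ltn_neqAle eq_sym ne lel.
  have := card_level_ge ln.
  have -> : [set x : G | (l.+1 <= level x)%N] = [set: G].
    by apply/setP => x; rewrite !finset.in_set lt.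
  rewrite cardsT mulfV // => /eqP; rewrite eq_sym invr_eq1 pnatr_eq1.
  by move=> /eqP e; move: l2; rewrite e.
rewrite /sep_dist; apply/eqP; rewrite eq_le; apply/andP; split.
  have le_x y : 1 - law y / unif R G y <= 1 - density l.
    by rewrite sepE lerB // density_mono ?level_le.
  by elim/big_ind: _ => // a b ha hb; rewrite ge_max ha.
rewrite -{1}lx -sepE; apply: le_bigmax.
Qed.

End Distances.

(** * Limits of sums and the mean number of cards never moved *)

Local Open Scope classical_set_scope.
Local Open Scope ring_scope.

Lemma cvgn_sum (R : realType) N (f : nat -> nat -> R) (g : nat -> R) :
  (forall l, f n l @[n --> \oo] --> g l) ->
  \sum_(l < N) f n l @[n --> \oo] --> \sum_(l < N) g l.
Proof.
move=> fg; apply: (@cvg_big R^o _ +%R 0 xpredT (@add_continuous R^o) _ _ _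
  (fun (l : 'I_N) n => f n l)) => l _; exact: fg.
Qed.

Lemma cvgn_prod (R : realType) N (f : nat -> nat -> R) (g : nat -> R) :
  (forall l, f n l @[n --> \oo] --> g l) ->
  \prod_(l < N) f n l @[n --> \oo] --> \prod_(l < N) g l.
Proof.
move=> fg; apply: (@cvg_big R^o _ *%R 1 xpredT (@mul_continuous R) _ _ _
  (fun (l : 'I_N) n => f n l)) => l _; exact: fg.
Qed.

(** Dominated convergence for series: the tails of all the sums are bounded by the
    tail of F, and on a fixed initial segment the limit is termwise. *)
Lemma tannery (R : realType) (f : nat -> nat -> R) (g F : nat -> R) :
  (forall l, f n l @[n --> \oo] --> g l) ->
  (\forall n \near \oo, forall l, (l <= n)%N -> `|f n l| <= F l) ->
  cvgn (series F) ->
  \sum_(l < n.+1) f n l @[n --> \oo] --> limn (series g).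
Proof.
move=> fg fF cF.
have gF l : `|g l| <= F l.
  apply: (@cvgr_to_le _ \oo _ _ (fun n => `|f n l|)).
    exact: (cvg_norm (fg l)).
  near=> n; suff: (l <= n)%N by near: n; apply: filterS fF => n; exact.
  by near: n; exact: nbhs_infty_ge.
have F0 l : 0 <= F l by apply: le_trans (gF l).
have cg : cvgn (series g).
  apply: normed_cvg; apply: (@series_le_cvg _ (fun l => `|g l|) F) => //.
have ndF : nondecreasing_seq (series F) by apply: nondecreasing_series => n _ _; exact: F0.
apply/cvgrPdist_lt => e e0; have e3 : 0 < e / 3 by lra.
have [M [tF tg]] : exists M, limn (series F) - series F M < e / 3 /\
    `|limn (series g) - series g M| < e / 3.
  have /cvgrPdist_lt/(_ _ e3) h1 := cF; have /cvgrPdist_lt/(_ _ e3) h2 := cg.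
  have [N _ h] := filterI h1 h2; exists N; have [l1 l2] := h N (leqnn N).
  by split=> //; apply: le_lt_trans l1; exact: ler_norm.
have tail n : \sum_(M <= l < n.+1) F l < e / 3.
  apply: le_lt_trans tF; have [le|lt] := leqP M n.+1.
    by rewrite -sub_series_geq // lerB // nondecreasing_cvgn_le.
  by rewrite big_geq ?(ltnW lt) // subr_ge0 nondecreasing_cvgn_le.
have head : \forall n \near \oo, `|\sum_(l < M) g l - \sum_(l < M) f n l| < e / 3.
  by have /cvgrPdist_lt/(_ _ e3) := @cvgn_sum R M f g fg.
near=> n; have Mn : (M <= n.+1)%N by near: n; exists M => // n /=; lia.
have fFn : forall l, (l <= n)%N -> `|f n l| <= F l by near: n.
have hn : `|\sum_(l < M) g l - \sum_(l < M) f n l| < e / 3 by near: n.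
rewrite -(big_mkord xpredT (f n)) (@big_cat_nat _ _ _ M 0 n.+1) //= !big_mkord.
have ht : `|\sum_(M <= l < n.+1) f n l| < e / 3.
  apply: le_lt_trans (tail n); apply: le_trans (ler_norm_sum _ _ _) _.
  rewrite !big_nat; apply: ler_sum => l /andP[_ ln]; exact: fFn.
have sg : series g M = \sum_(l < M) g l by rewrite /series /= big_mkord.
move: (tg) hn ht; rewrite sg !ltr_norml; lra.
Unshelve. all: by end_near. Qed.

Lemma bernoulli_le (R : realType) (d : R) K : 0 <= d <= 1 -> 1 - K%:R * d <= (1 - d) ^+ K.
Proof.
move=> d01; elim: K => [|K IH]; first by rewrite mul0r subr0 expr0.
rewrite exprS -natr1; have : (1 - d) * (1 - K%:R * d) <= (1 - d) * (1 - d) ^+ K.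
  by rewrite ler_wpM2l //; lra.
have : 0 <= K%:R * d * d by rewrite !mulr_ge0 //; lra.
by move=> *; nra.
Qed.

(** ln (e n) < e n for every e > 0. *)
Lemma cvg_ln_div (R : realType) : (ln n%:R / n%:R : R) @[n --> \oo] --> 0.
Proof.
apply/cvgrPdist_le => e e0.
near=> n; rewrite sub0r normrN.
have n1 : (1 <= n)%N by near: n; exact: nbhs_infty_ge.
have n1R : (1 : R) <= n%:R by rewrite ler1n.
have n0 : (0 : R) < n%:R by apply: lt_le_trans n1R.
rewrite ger0_norm; last by rewrite divr_ge0 // ln_ge0.
rewrite ler_pdivrMr //.
have e2 : 0 < e / 2 by lra.
have big : - ln (e / 2) / (e / 2) <= n%:R by near: n; exact: nbhs_infty_ger.
rewrite ler_pdivrMr // in big.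
have := ln_sublinear (mulr_gt0 e2 n0); rewrite lnM ?posrE // => h.
lra.
Unshelve. all: by end_near. Qed.

Lemma cvg_inv_n (R : realType) : (n%:R^-1 : R) @[n --> \oo] --> 0.
Proof.
rewrite -cvg_shiftS; exact: cvg_harmonic.
Qed.

Section Regime.
Variable R : realType.
Implicit Types (x : nat -> R) (K : nat -> nat) (a alpha : R).

(** As ln n tends to infinity while ln n + k ln (1 - x) stays bounded, k is
    eventually positive, and the absolute value agrees with it. *)
Lemma near_k_abs x (k : nat -> int) a : (\forall n \near \oo, 0 < x n < 1) ->
  (ln (n%:R : R) - (k n)%:~R * - ln (1 - x n)) @[n --> \oo] --> a ->
  \forall n \near \oo, (k n)%:~R = `|k n|%N%:R :> R.
Proof.
move=> hx hk; near=> n.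
have n1 : (1 <= n)%N by near: n; exact: nbhs_infty_ge.
have h1 : ln (n%:R : R) - (k n)%:~R * - ln (1 - x n) < a + 1.
  by near: n; apply: (cvgr_lt a hk); lra.
have h2 : a + 1 <= ln (n%:R : R).
  rewrite -ler_expR lnK ?posrE ?ltr0n //.
  by near: n; exact: nbhs_infty_ger.
have xn : 0 < x n < 1 by near: n.
have d0 : 0 < - ln (1 - x n) by rewrite oppr_gt0 ln_lt0 //; lra.
have k0 : 0 < (k n)%:~R * - ln (1 - x n) by lra.
rewrite pmulr_lgt0 // in k0.
by rewrite natr_absz ger0_norm // -(ler0z R) ltW.
Unshelve. all: by end_near. Qed.

Lemma cvg_mean x K a : (\forall n \near \oo, 0 < x n < 1) ->
  (ln (n%:R : R) + (K n)%:R * ln (1 - x n)) @[n --> \oo] --> a ->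
  (n%:R * (1 - x n) ^+ K n) @[n --> \oo] --> expR a.
Proof.
move=> hx hK.
have h := cvg_comp _ _ hK (@continuous_expR R a).
apply: cvg_trans h; apply: near_eq_cvg; near=> n.
have n1 : (1 <= n)%N by near: n; exact: nbhs_infty_ge.
have xn : 0 < x n < 1 by near: n.
rewrite /= expRD lnK ?posrE ?ltr0n // expRM_natl lnK // posrE; lra.
Unshelve. all: by end_near. Qed.

(** The number of steps is of order ln n, because - ln (1 - x) >= x is bounded
    below. *)
Lemma cvg_steps_div x K a alpha : (\forall n \near \oo, 0 < x n < 1) ->
  0 < alpha -> x n @[n --> \oo] --> alpha ->
  (ln (n%:R : R) + (K n)%:R * ln (1 - x n)) @[n --> \oo] --> a ->
  ((K n)%:R / n%:R : R) @[n --> \oo] --> 0.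
Proof.
move=> hx alpha0 xa hK.
have up : ((ln n%:R / n%:R + (1 - a) / n%:R) / x n) @[n --> \oo] --> 0.
  have -> : 0 = (0 + (1 - a) * 0) / alpha by rewrite mulr0 addr0 mul0r.
  apply: cvgM; last by apply: cvgV => //; rewrite gt_eqF.
  by apply: cvgD; [exact: cvg_ln_div|apply: cvgM; [exact: cvg_cst|exact: cvg_inv_n]].
apply: (squeeze_cvgr _ (cvg_cst 0) up); near=> n.
have n1 : (1 <= n)%N by near: n; exact: nbhs_infty_ge.
have n0 : (0 : R) < n%:R by rewrite ltr0n.
have xn : 0 < x n < 1 by near: n.
have /andP[x0 x1] := xn.
have h1 : a - 1 < ln (n%:R : R) + (K n)%:R * ln (1 - x n).
  by near: n; apply: (cvgr_gt a hK); lra.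
rewrite divr_ge0 //= ler_pdivlMr // -mulrDl mulrAC ler_pM2r ?invr_gt0 //.
have ln_x : ln (1 - x n) <= - x n by apply: le_ln1Dx; lra.
have : (K n)%:R * ln (1 - x n) <= (K n)%:R * - x n by rewrite ler_wpM2l.
lra.
Unshelve. all: by end_near. Qed.

End Regime.

(** * The Poisson limit *)

Lemma ffact_ratio_le (n m r : nat) : (m <= n)%N ->
  ((n - m) ^_ r * n ^ r <= n ^_ r * (n - m) ^ r)%N.
Proof.
move=> mn; elim: r => [|r IH]; first by rewrite !ffactn0 !expn0.
rewrite !ffactnSr !expnSr mulnACA [X in (_ <= X)%N]mulnACA leq_mul //.
by nia.
Qed.

Lemma ffact_le_exp (n r : nat) : (n ^_ r <= n ^ r)%N.
Proof. by elim: r => // r IH; rewrite ffactnSr expnSr leq_mul ?leq_subr. Qed.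

Lemma untouched_moment_le (R : realFieldType) n m k r : (0 < n)%N -> (m <= n)%N ->
  untouched_moment R n m k r <= (n%:R * (1 - m%:R / n%:R) ^+ k) ^+ r / r`!%:R.
Proof.
move=> n0 mn; have nR : 0 < n%:R :> R by rewrite ltr0n.
have f0 : 0 < r`!%:R :> R by rewrite ltr0n fact_gt0.
have x1 : 0 <= 1 - m%:R / n%:R :> R by rewrite subr_ge0 ler_pdivrMr // mul1r ler_nat.
have [nr|rn] := ltnP n r.
  by rewrite /untouched_moment bin_small // mul0r divr_ge0 ?exprn_ge0 ?mulr_ge0 ?exprn_ge0 // ltW.
have b0 : 0 < 'C(n, r)%:R :> R by rewrite ltr0n bin_gt0.
have ratio : 'C(n - m, r)%:R / 'C(n, r)%:R <= (1 - m%:R / n%:R) ^+ r :> R.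
  rewrite ler_pdivrMr // -(ler_pM2r f0) -mulrA -!natrM !bin_ffact.
  have -> : 1 - m%:R / n%:R = (n - m)%:R / n%:R :> R.
    by rewrite natrB // mulrBl mulfV // gt_eqF.
  rewrite expr_div_n mulrAC ler_pdivlMr ?exprn_gt0 // -!natrX -!natrM ler_nat.
  by rewrite mulnC [X in (_ <= X)%N]mulnC mulnC ffact_ratio_le.
have bn : 'C(n, r)%:R <= n%:R ^+ r / r`!%:R :> R.
  rewrite ler_pdivlMr // -natrM -natrX ler_nat bin_ffact.
  exact: ffact_le_exp.
rewrite exprMn mulrAC /untouched_moment; apply: ler_pM => //.
by rewrite exprAC lerXn2r // nnegrE ?divr_ge0 ?exprn_ge0.
Qed.

Lemma untouched_moment_ge0 (R : realFieldType) n m k r : 0 <= untouched_moment R n m k r.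
Proof. by rewrite mulr_ge0 // exprn_ge0 // divr_ge0. Qed.

Section Limits.
Variable R : realType.
Implicit Types (m K : nat -> nat) (alpha lambda : R).

(** With x = m/n and y = i/n, the base of the power is (1 - x)(1 - d) for
    d = x y / ((1 - y)(1 - x)), so that the factor is the mean times
    (1 - y)(1 - d)^K.  Here K d is of order K / n and tends to 0, and the Bernoulli
    inequality gives the limit 1 for the last power. *)
Lemma cvg_untouched_factor m K alpha lambda i :
  (\forall n \near \oo, 0 < ((m n)%:R / n%:R : R) < 1) ->
  alpha < 1 -> ((m n)%:R / n%:R : R) @[n --> \oo] --> alpha ->
  ((K n)%:R / n%:R : R) @[n --> \oo] --> 0 ->
  (n%:R * (1 - (m n)%:R / n%:R) ^+ K n : R) @[n --> \oo] --> lambda ->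
  ((n - i)%:R * ((n - m n - i)%:R / (n - i)%:R) ^+ K n : R) @[n --> \oo] --> lambda.
Proof.
move=> hx alpha1 xa Kn mean.
pose x n : R := (m n)%:R / n%:R; pose y n : R := i%:R / n%:R.
pose d n : R := x n * y n / ((1 - y n) * (1 - x n)).
have y0 : y n @[n --> \oo] --> 0.
  rewrite -(mulr0 i%:R); apply: cvgM; [exact: cvg_cst|exact: cvg_inv_n].
have y1 : (1 - y n) @[n --> \oo] --> (1 : R).
  rewrite -[X in _ --> X](subr0 1); apply: cvgB => //; exact: cvg_cst.
have near_small : \forall n \near \oo, y n < (1 - alpha) / 2.
  by apply: (cvgr_lt 0 y0); lra.
have near_x : \forall n \near \oo, x n < (1 + alpha) / 2.
  by apply: (cvgr_lt alpha xa); lra.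
(* K d = (K / n) (i x / ((1 - y)(1 - x))), where the last factor converges. *)
have Kd : ((K n)%:R * d n) @[n --> \oo] --> 0.
  pose e n : R := (K n)%:R / n%:R * (i%:R * x n / ((1 - y n) * (1 - x n))).
  have e0 : e n @[n --> \oo] --> 0.
    have -> : 0 = 0 * (i%:R * alpha / (1 * (1 - alpha))) by rewrite mul0r.
    apply: cvgM => //; apply: cvgM; first by apply: cvgM => //; exact: cvg_cst.
    apply: cvgV; first by rewrite mul1r subr_eq0 gt_eqF.
    by apply: cvgM => //; apply: cvgB => //; exact: cvg_cst.
  apply: cvg_trans e0; apply: near_eq_cvg; near=> n.
  by rewrite /e /d /y; ring.
have dK : ((1 - d n) ^+ K n) @[n --> \oo] --> (1 : R).
  have lo : (1 - (K n)%:R * d n) @[n --> \oo] --> (1 : R).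
    rewrite -[X in _ --> X](subr0 1); apply: cvgB => //; exact: cvg_cst.
  have hi : (fun=> 1 : R) @ \oo --> (1 : R) by exact: cvg_cst.
  apply: (squeeze_cvgr _ lo hi); near=> n.
  have xn : 0 < x n < 1 by near: n.
  have yn : 0 <= y n by rewrite /y divr_ge0.
  have ys : y n < (1 - alpha) / 2 by near: n.
  have xs : x n < (1 + alpha) / 2 by near: n.
  have D0 : 0 < (1 - y n) * (1 - x n) by rewrite mulr_gt0 //; lra.
  have d01 : 0 <= d n <= 1.
    have xy0 : 0 <= x n * y n by rewrite mulr_ge0 //; lra.
    rewrite /d (divr_ge0 xy0 (ltW D0)) /=.
    by rewrite ler_pdivrMr // mul1r; nra.
  by rewrite bernoulli_le //= exprn_ile1 //; lra.
have lim : (n%:R * (1 - x n) ^+ K n * (1 - y n) * (1 - d n) ^+ K n) @[n --> \oo] --> lambda.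
  by rewrite -[lambda]mulr1 -[lambda * 1]mulr1; apply: cvgM => //; apply: cvgM.
apply: cvg_trans lim; apply: near_eq_cvg; near=> n.
have n1 : (1 <= n)%N by near: n; exact: nbhs_infty_ge.
have n0 : (0 : R) < n%:R by rewrite ltr0n.
have xn : 0 < x n < 1 by near: n.
have ys : y n < (1 - alpha) / 2 by near: n.
have xs : x n < (1 + alpha) / 2 by near: n.
have mE : (m n)%:R = x n * n%:R by rewrite /x divfK // gt_eqF.
have iE : i%:R = y n * n%:R by rewrite /y divfK // gt_eqF.
have mi : (m n + i <= n)%N.
  by rewrite -(ler_nat R) natrD mE iE -mulrDl -[X in _ <= X]mul1r ler_pM2r //; lra.
have -> : (n - i)%:R = n%:R * (1 - y n) :> R by rewrite natrB; [rewrite iE; ring|lia].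
have -> : (n - m n - i)%:R = n%:R * (1 - x n - y n) :> R.
  by rewrite !natrB; [rewrite iE mE; ring|lia|lia].
have ny0 : 1 - y n != 0 by rewrite gt_eqF //; lra.
have nx0 : 1 - x n != 0 by rewrite gt_eqF //; lra.
have -> : n%:R * (1 - x n - y n) / (n%:R * (1 - y n)) = (1 - x n) * (1 - d n).
  by rewrite /d; field; rewrite ny0 nx0 gt_eqF.
by rewrite exprMn; ring.
Unshelve. all: by end_near. Qed.

(** Expanding the binomials as falling factorials writes the moment as a product of
    the factors of [cvg_untouched_factor] divided by r!. *)
Lemma cvg_untouched_moment m K alpha lambda r :
  (\forall n \near \oo, 0 < ((m n)%:R / n%:R : R) < 1) ->
  alpha < 1 -> ((m n)%:R / n%:R : R) @[n --> \oo] --> alpha ->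
  ((K n)%:R / n%:R : R) @[n --> \oo] --> 0 ->
  (n%:R * (1 - (m n)%:R / n%:R) ^+ K n : R) @[n --> \oo] --> lambda ->
  untouched_moment R n (m n) (K n) r @[n --> \oo] --> lambda ^+ r / r`!%:R.
Proof.
move=> hx alpha1 xa Kn mean.
have lim : (\prod_(i < r) ((n - i)%:R * ((n - m n - i)%:R / (n - i)%:R) ^+ K n) / r`!%:R)
    @[n --> \oo] --> lambda ^+ r / r`!%:R.
  apply: cvgM; last exact: cvg_cst.
  have -> : lambda ^+ r = \prod_(i < r) lambda by rewrite prodr_const card_ord.
  apply: (@cvgn_prod _ r (fun n i => (n - i)%:R * ((n - m n - i)%:R / (n - i)%:R) ^+ K n)
            (fun=> lambda)) => i.
  exact: (cvg_untouched_factor i hx alpha1 xa Kn mean).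
apply: cvg_trans lim; apply: near_eq_cvg; near=> n.
have rn : (r <= n)%N by near: n; exact: nbhs_infty_ge.
have f0 : r`!%:R != 0 :> R by rewrite pnatr_eq0 -lt0n fact_gt0.
have binE N : 'C(N, r)%:R = (\prod_(i < r) (N - i)%:R) / r`!%:R :> R.
  by rewrite -natr_prod -ffact_prod -bin_ffact natrM mulfK.
rewrite /untouched_moment !binE big_split /= prodrXl prodf_div mulrAC; congr (_ * _ ^+ _).
by rewrite invfM invrK mulrACA mulVf ?mulr1.
Unshelve. all: by end_near. Qed.

(** The bound mean^r / r! on the moments dominates the inclusion-exclusion sum by an
    exponential series, and the limit of the sum is lambda^u / u! times the series
    of exp (- lambda). *)
Lemma cvg_untouched_law m K lambda u :
  (\forall n \near \oo, (m n <= n)%N) ->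
  (n%:R * (1 - (m n)%:R / n%:R) ^+ K n : R) @[n --> \oo] --> lambda ->
  (forall r, untouched_moment R n (m n) (K n) r @[n --> \oo] --> lambda ^+ r / r`!%:R) ->
  untouched_law R n (m n) (K n) u @[n --> \oo] --> lambda ^+ u / u`!%:R * expR (- lambda).
Proof.
move=> mn mean mom; set c := lambda + 1.
pose f n s := (-1) ^+ s * 'C(u + s, u)%:R * untouched_moment R n (m n) (K n) (u + s).
pose g s : R := (-1) ^+ s * 'C(u + s, u)%:R * (lambda ^+ (u + s) / (u + s)`!%:R).
have f0 r : r`!%:R != 0 :> R by rewrite pnatr_eq0 -lt0n fact_gt0.
have binE s (t : R) : 'C(u + s, u)%:R * (t ^+ (u + s) / (u + s)`!%:R) =
    t ^+ u / u`!%:R * exp_coeff t s.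
  have := bin_fact (leq_addr s u); rewrite addKn => <-.
  rewrite /exp_coeff /= !natrM exprD; field.
  by rewrite !f0 pnatr_eq0 -lt0n bin_gt0 leq_addr.
have gE : g = fun s => lambda ^+ u / u`!%:R * exp_coeff (- lambda) s.
  apply/funext => s; rewrite /g -mulrA binE mulrCA; congr (_ * _).
  by rewrite /exp_coeff /= mulrA -exprMn mulN1r.
have <- : limn (series g) = lambda ^+ u / u`!%:R * expR (- lambda).
  rewrite gE seriesZ; apply: cvg_lim => //.
  by apply: cvgZr => //; exact: is_cvg_series_exp_coeff.
apply: (@tannery _ f g (fun s => c ^+ u / u`!%:R * exp_coeff c s)).
- by move=> s; apply: cvgM; [exact: cvg_cst|exact: mom].
- near=> n => s sn; rewrite /f -mulrA normrM normrX normrN1 expr1n mul1r.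
  rewrite ger0_norm ?mulr_ge0 ?untouched_moment_ge0 // -binE ler_wpM2l //.
  have n0 : (0 < n)%N by near: n; exact: nbhs_infty_ge.
  have mnn : (m n <= n)%N by near: n.
  apply: le_trans (untouched_moment_le _ _ _ n0 mnn) _.
  have mean_c : n%:R * (1 - (m n)%:R / n%:R) ^+ K n <= c.
    by near: n; apply: (cvgr_le lambda mean); rewrite /c; lra.
  have mean0 : 0 <= n%:R * (1 - (m n)%:R / n%:R) ^+ K n :> R.
    rewrite mulr_ge0 // exprn_ge0 // subr_ge0 ler_pdivrMr ?ltr0n //.
    by rewrite mul1r ler_nat.
  by rewrite ler_wpM2r // lerXn2r ?nnegrE // (le_trans mean0).
- rewrite seriesZ; apply: is_cvgZr; exact: is_cvg_series_exp_coeff.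
Unshelve. all: by end_near. Qed.
End Limits.

(** * Limits of the distances *)

Lemma cvg_max0 (R : realType) (u : nat -> R) (l : R) :
  u n @[n --> \oo] --> l -> Num.max (u n) 0 @[n --> \oo] --> Num.max l 0.
Proof.
move=> ul; have h : {for l, continuous ((id : R -> R) \max (fun=> 0))}.
  by apply: continuous_max; [exact: cvg_id|exact: cvg_cst].
exact: (cvg_comp _ _ ul h).
Qed.

Section ProfileLimits.
Variables (R : realType) (p : nat).
Hypothesis p_gt0 : (0 < p)%N.
Implicit Types (m K : nat -> nat) (lambda : R).

Lemma cvg_density m K lambda l :
  (forall u, untouched_law R n (m n) (K n) u @[n --> \oo] -->
     lambda ^+ u / u`!%:R * expR (- lambda)) ->
  density R n p (m n) (K n) l @[n --> \oo] --> profile_s p l lambda.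
Proof.
move=> hu; have -> : profile_s p l lambda =
    \sum_(u < l.+1) lambda ^+ u / u`!%:R * expR (- lambda) * (u`! * p ^ u)%:R.
  rewrite /profile_s mulr_sumr; apply: eq_bigr => u _.
  have f0 : u`!%:R != 0 :> R by rewrite pnatr_eq0 -lt0n fact_gt0.
  by rewrite natrM natrX exprMn; field.
apply: (@cvgn_sum _ l.+1 (fun n u => untouched_law R n (m n) (K n) u * (u`! * p ^ u)%:R)
  (fun u => lambda ^+ u / u`!%:R * expR (- lambda) * (u`! * p ^ u)%:R)) => u.
by apply: cvgM; [exact: hu|exact: cvg_cst].
Qed.

Lemma level_prob_bounds n l : (l <= n)%N ->
  0 <= level_prob R n p l <= ((l`! * p ^ l)%:R)^-1.
Proof.
move=> ln; have pos j : (0 < j`! * p ^ j)%N by rewrite muln_gt0 fact_gt0 expn_gt0 p_gt0.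
rewrite /level_prob; case: ifP => _; last by rewrite subr0 invr_ge0 ler0n lexx.
rewrite subr_ge0 gerBl invr_ge0 ler0n andbT lef_pV2 ?posrE ?ltr0n //.
by rewrite ler_nat leq_mul // ?factS ?expnS ?leq_pmull.
Qed.

Lemma level_prob_eq n l : (l < n)%N -> level_prob R n p l = profile_a R p l.
Proof. by move=> ln; rewrite /level_prob ln /profile_a !natrM !natrX. Qed.

(** For u <= l one has P(U = u) u! <= c^u, so that the density is at most
    (l + 1)(p c)^l <= (2 p c)^l, and a uniform deck has level l with probability at
    most 1 / (l! p^l). *)
Lemma level_term_le (n m k l : nat) (c : R) : (0 < n)%N -> (m <= n)%N -> (l <= n)%N ->
  1 <= c -> n%:R * (1 - m%:R / n%:R) ^+ k <= c ->
  `|level_prob R n p l * Num.max (density R n p m k l - 1) 0| <= exp_coeff (2 * c) l.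
Proof.
move=> n0 mn ln c1 mean_c; have /andP[b0 b1] := level_prob_bounds ln.
have c0 : 0 <= c by lra.
have p1 : 1 <= p%:R :> R by rewrite ler1n.
have mean0 : 0 <= n%:R * (1 - m%:R / n%:R) ^+ k :> R.
  rewrite mulr_ge0 // exprn_ge0 // subr_ge0 ler_pdivrMr ?ltr0n //.
  by rewrite mul1r ler_nat.
have dens : density R n p m k l <= (2 * c) ^+ l * p%:R ^+ l.
  apply: (@le_trans _ _ (\sum_(u < l.+1) c ^+ l * p%:R ^+ l)).
    apply: ler_sum => u _; have ul : (u <= l)%N by rewrite -ltnS.
    have [/(_ u (leq_trans ul ln))/andP[_ h] _ _] := conv_pow_mixture R k p_gt0 mn.
    have f0 : 0 < u`!%:R :> R by rewrite ltr0n fact_gt0.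
    rewrite natrM natrX mulrA ler_pM ?exprn_ge0 // ?ler_weXn2l //.
      by rewrite mulr_ge0 // (untouched_law_ge0 R k p_gt0 mn) // (leq_trans ul).
    apply: (@le_trans _ _ (c ^+ u)); last by rewrite ler_weXn2l.
    rewrite -ler_pdivlMr //; apply: le_trans h _.
    apply: le_trans (untouched_moment_le _ _ _ n0 mn) _.
    by rewrite ler_wpM2r // lerXn2r ?nnegrE.
  rewrite sumr_const card_ord -[leLHS]mulr_natr exprMn -[leRHS]mulrA [leRHS]mulrC.
  rewrite ler_wpM2l ?mulr_ge0 ?exprn_ge0 //.
  by rewrite -natrX ler_nat ltn_expl.
have max_le : 0 <= Num.max (density R n p m k l - 1) 0 <= (2 * c) ^+ l * p%:R ^+ l.
  rewrite le_max lexx orbT ge_max; apply/and3P; split=> //; first by lra.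
  by rewrite mulr_ge0 // exprn_ge0 //; lra.
have /andP[M0 M1] := max_le.
rewrite ger0_norm ?mulr_ge0 // mulrC.
apply: le_trans (ler_pM M0 b0 M1 b1) _.
have f0 : l`!%:R != 0 :> R by rewrite pnatr_eq0 -lt0n fact_gt0.
have pl0 : p%:R ^+ l != 0 :> R by rewrite expf_neq0 // pnatr_eq0 -lt0n.
rewrite natrM natrX /exp_coeff /= le_eqVlt; apply/orP; left; apply/eqP; field.
by rewrite f0 pl0.
Qed.

Lemma cvg_tv_dist m K lambda :
  (\forall n \near \oo, (m n <= n)%N) -> 0 <= lambda ->
  (n%:R * (1 - (m n)%:R / n%:R) ^+ K n : R) @[n --> \oo] --> lambda ->
  (forall l, density R n p (m n) (K n) l @[n --> \oo] --> profile_s p l lambda) ->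
  tv_dist (conv_pow (top_to_random n p (m n) R) (K n)) (unif R (colored_perm n p))
    @[n --> \oo] -->
  limn (series (fun l => profile_a R p l * Num.max (profile_s p l lambda - 1) 0)).
Proof.
move=> mn lambda0 mean dens.
have lim := @tannery R
  (fun n l => level_prob R n p l * Num.max (density R n p (m n) (K n) l - 1) 0)
  (fun l => profile_a R p l * Num.max (profile_s p l lambda - 1) 0)
  (exp_coeff (2 * (lambda + 1))).
apply: cvg_trans (lim _ _ _).
- apply: near_eq_cvg; near=> n; rewrite tv_dist_density //.
  by near: n.
- move=> l; apply: cvgM; last first.
    by apply: cvg_max0; apply: cvgB; [exact: dens|exact: cvg_cst].
  have cst : (fun=> profile_a R p l : R) @ \oo --> profile_a R p l by exact: cvg_cst.
  apply: cvg_trans cst; apply: near_eq_cvg; near=> n.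
  rewrite level_prob_eq //; near: n; exact: nbhs_infty_gt.
- near=> n => l ln; apply: level_term_le => //.
  + by near: n; exact: nbhs_infty_ge.
  + by near: n.
  + by lra.
  + by near: n; apply: (cvgr_le lambda mean); lra.
- exact: is_cvg_series_exp_coeff.
Unshelve. all: by end_near. Qed.

End ProfileLimits.

Theorem corollary5p2 (R : realType) (m : nat -> nat) (alpha : R)
    (hm : forall n : nat, (2 <= n)%N -> (1 <= m n <= n.-1)%N)
    (halpha : 0 < alpha < 1)
    (hmalpha : ((m n)%:R / n%:R : R) @[n --> \oo] --> alpha)
    (k : nat -> int) (a : R)
    (hk : (ln (n%:R : R) - (k n)%:~R * - ln (1 - (m n)%:R / n%:R : R))
            @[n --> \oo] --> a)
    (p : nat) (hp : (1 <= p)%N) :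
  (tv_dist (conv_pow (top_to_random n p (m n) R) `|k n|%N)
           (unif R (colored_perm n p)))
    @[n --> \oo] --> profile p (- a)
  /\
  (sep_dist (conv_pow (top_to_random n p (m n) R) `|k n|%N)
            (unif R (colored_perm n p)))
    @[n --> \oo] -->
    (if p == 1%N then 1 - expR (- expR a) * (1 + expR a)
     else 1 - expR (- expR a)).
Proof.
have /andP[alpha0 alpha1] := halpha.
pose K n := `|k n|%N.
have hx : \forall n \near \oo, 0 < ((m n)%:R / n%:R : R) < 1.
  near=> n; have n2 : (2 <= n)%N by near: n; exact: nbhs_infty_ge.
  have /andP[m1 mn] := hm _ n2; have n0 : (0 : R) < n%:R by rewrite ltr0n; lia.
  apply/andP; split; first by rewrite divr_gt0 // ltr0n.
  by rewrite ltr_pdivrMr // mul1r ltr_nat; lia.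
have mn : \forall n \near \oo, (m n <= n)%N.
  near=> n; have n2 : (2 <= n)%N by near: n; exact: nbhs_infty_ge.
  by have /andP[_] := hm _ n2; lia.
have hK : (ln (n%:R : R) + (K n)%:R * ln (1 - (m n)%:R / n%:R)) @[n --> \oo] --> a.
  have kK := near_k_abs hx hk.
  apply: cvg_trans hk; apply: near_eq_cvg; near=> n.
  by rewrite mulrN opprK; congr (_ + _ * _); near: n.
have mean := cvg_mean hx hK.
have steps := cvg_steps_div hx alpha0 hmalpha hK.
have mom r := @cvg_untouched_moment R m K alpha (expR a) r hx alpha1 hmalpha steps mean.
have law u := @cvg_untouched_law R m K (expR a) u mn mean mom.
have dens l := @cvg_density R p m K (expR a) l law.
split.
  rewrite /profile opprK; apply: (cvg_tv_dist hp mn _ mean dens).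
  by rewrite expR_ge0.
have sep l : (l`! * p ^ l = 1)%N -> (1 < l.+1`! * p ^ l.+1)%N ->
    sep_dist (conv_pow (top_to_random n p (m n) R) (K n)) (unif R (colored_perm n p))
      @[n --> \oo] --> 1 - profile_s p l (expR a).
  move=> l1 l2; apply: cvg_trans (cvgB (cvg_cst (1 : R)) (dens l)).
  apply: near_eq_cvg; near=> n; rewrite (sep_dist_density _ _ _ _ _ l1 l2) //.
    by near: n.
  by near: n; exact: nbhs_infty_gt.
case: eqP => [p1|p1].
  have := sep 1%N; rewrite /profile_s p1 big_ord_recl big_ord1 /= expr0 expr1 mul1r.
  exact.
have := sep 0%N; rewrite /profile_s big_ord1 expr0 mulr1; apply=> //.
by rewrite mul1n expn1; lia.
Unshelve. all: by end_near. Qed.
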